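(* Let $\epsilon\in[0,1]$ and let $C^{\mathrm{fb}}_\epsilon$ be the capacity of the $(1,\infty)$-RLL input-constrained binary erasure channel with erasure probability $\epsilon$ and with feedback. Then $$C^{\mathrm{fb}}_{\epsilon}=\max_{0\le p\le \frac12}\frac{H_b(p)}{p+\frac{1}{1-\epsilon}},$$ where for $\epsilon=1$ the right-hand side is read as $0$. Furthermore, the capacity is achieved by an explicit zero-error coding scheme, namely the scheme given by the encoding procedure and the decoding procedure described in the context.
   Context: $H_b(\alpha)=-\alpha\log_2\alpha-(1-\alpha)\log_2(1-\alpha)$ is the binary entropy function (with $0\log_2 0=0$), and $\bar\alpha=1-\alpha$. Channel. Input alphabet $\mathcal X=\{0,1\}$, output alphabet $\mathcal Y=\{0,1,?\}$. The channel is memoryless: the output at time $i$, given the existing information in the system, depends only on the current input, $p(y_i|x^i,y^{i-1})=p(y_i|x_i)$, where $y_i=?$ (an erasure) with probability $\epsilon$ and $y_i=x_i$ with probability $1-\epsilon$. Codes. An $(n,2^{nR},(1,\infty))$ code with feedback consists of encoding functions $f_i:\{1,\dots,2^{nR}\}\times\mathcal Y^{i-1}\to\mathcal X$, $i=1,\dots,n$, satisfying $f_i(m,y^{i-1})=0$ whenever $f_{i-1}(m,y^{i-2})=1$, for all $(m,y^{i-1})$ (no two consecutive ones), and a decoding function $\Psi:\mathcal Y^n\to\{1,\dots,2^{nR}\}$. The message $M$ is uniform on $\{1,\dots,2^{nR}\}$, the inputs are $X_i=f_i(M,Y^{i-1})$, and $P_e^{(n)}=\Pr(M\ne\Psi(Y^n))$.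 A rate $R$ is achievable if there is a sequence of $(n,2^{nR},(1,\infty))$ codes with $P_e^{(n)}\to0$. $C^{\mathrm{fb}}_\epsilon$ is the supremum of achievable rates. The coding scheme. Let $p=p_\epsilon$ be the maximizer of $H_b(p)/(p+\frac1{1-\epsilon})$ over $[0,\frac12]$ and let $q=\frac{p}{1-p}$. The messages are identified with the points $\{k/2^{nR}\}_{k=0}^{2^{nR}-1}$ of the unit interval. Two labellings of the unit interval are used: $L_1$ labels $[\bar p,1)$ by '1' and $[0,\bar p)$ by '0'; $L_2$ labels $[\bar p\bar q,\bar p)$ by '1' and $[0,\bar p\bar q)\cup[\bar p,1)$ by '0'. Thus each is obtained from the other by exchanging the labels of $[\bar p\bar q,\bar p)$ and $[\bar p,1)$. The set of possible messages is the set of messages having positive probability given the outputs so far (initially all messages); it is known to the decoder and, through feedback, to the encoder. To expand a set of possible messages of size $K$ to the unit interval means to re-place its elements uniformly at the points $\{k/K\}_{k=0}^{K-1}$. Encoding procedure. While the set of possible messages contains more than one message, do the following. Label the unit interval according to $L_1$ and transmit the label of the sub-interval containing the message. While the received symbol is an erasure, exchange the labels of $[\bar p\bar q,\bar p)$ and $[\bar p,1)$ and transmit the label of the sub-interval containing the message. If the received (unerased) symbol is '0', the new set of possible messages consists of the messages within sub-intervals labelled '0'; otherwise it consists of the messages within sub-intervals labelled '1', and the encoder then transmits one '0'. Expand the set of possible messages to the unit interval. Decoding procedure. While the set of possible messages contains more than one message, do the following. Label the unit interval according to $L_1$. While the received symbol is an erasure, exchange the labels of $[\bar p\bar q,\bar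 p)$ and $[\bar p,1)$. If the received (unerased) symbol is '0', the new set of possible messages consists of the messages within sub-intervals labelled '0'; otherwise it consists of the messages within sub-intervals labelled '1', and the next received symbol is ignored. Expand the set of possible messages to the unit interval.
   Formalization: For ε=0 only, a set of possible messages that L_1 labels entirely '0' is labelled by L_2 instead; the literal procedure never ends there, since two remaining messages at 0 and 1/2 are both labelled '0' and, with no erasures, labels are never exchanged. *)

(* Defs.v *)
From HB Require Import structures.
From mathcomp Require Import all_boot all_order all_algebra.
From mathcomp Require Import all_classical all_reals all_analysis.

Set Implicit Arguments.
Unset Strict Implicit.
Unset Printing Implicit Defensive.

Import Order.TTheory GRing.Theory Num.Theory.
Import numFieldNormedType.Exports.

Local Open Scope classical_set_scope.
Local Open Scope ring_scope.

Definition log2 (R : realType) (x : R) : R := ln x / ln 2.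

(* The convention 0 log 0 = 0 is automatic. *)
Definition binary_entropy (R : realType) (a : R) : R :=
  - a * log2 a - (1 - a) * log2 (1 - a).

(* H_b(p) / (p + 1 / (1 - eps)), read as 0 for eps = 1. *)
Definition rate_fun (R : realType) (eps p : R) : R :=
  if eps == 1 then 0 else binary_entropy p / (p + 1 / (1 - eps)).

Definition is_maximizer (R : realType) (eps p : R) : Prop :=
  0 <= p <= 1 / 2 /\
  forall p', 0 <= p' <= 1 / 2 -> rate_fun eps p' <= rate_fun eps p.

(* Inputs are booleans; [None] is the erasure symbol. *)
Notation output := (option bool).

Definition bec (R : realType) (eps : R) (x : bool) (y : output) : R :=
  if y is Some b then (if b == x then 1 - eps else 0) else eps.

(* [enc m s], with s = y^(i-1), is the i-th input f_i(m, y^(i-1)); only the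
   values on sequences of length less than n matter. *)
Record fb_code (n K : nat) : Type := FbCode {
  enc : 'I_K -> seq output -> bool;
  dec : n.-tuple output -> 'I_K;
  no_consecutive_ones : forall (m : 'I_K) (s : seq output) (y : output),
    ((size s).+1 < n)%N -> enc m s -> ~~ enc m (rcons s y)
}.

(* Pr(Y^n = ys | M = m) for a memoryless channel used with feedback, when the
   inputs are given by e = f(m, .). *)
Definition output_prob (R : realType) (eps : R) (e : seq output -> bool)
    (ys : seq output) : R :=
  \prod_(i < size ys) bec eps (e (take i ys)) (nth None ys i).

Definition error_prob (R : realType) (eps : R) (n K : nat) (c : fb_code n K)
    : R :=
  K%:R^-1 * \sum_(m < K) \sum_(ys : n.-tuple output | dec c ys != m)
    output_prob eps (enc c m) ys.

(* The number 2^(nr) of messages, rounded up. *)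
Definition num_messages (R : realType) (r : R) (n : nat) : nat :=
  `|Num.ceil (2 `^ (n%:R * r))|%N.

Lemma num_messages_gt0 (R : realType) (r : R) (n : nat) :
  (0 < num_messages r n)%N.
Proof. by rewrite absz_gt0 gt_eqF// ceil_gt0 powR_gt0. Qed.

Definition achievable (R : realType) (eps r : R) : Prop :=
  0 <= r /\ exists c : forall n, fb_code n (num_messages r n),
    (fun n => error_prob eps (c n)) @ \oo --> (0 : R).

Definition fb_capacity (R : realType) (eps : R) : \bar R :=
  ereal_sup [set r%:E | r in [set r | achievable eps r]].

(* The label of the point x: L_1 if [sw] is false, L_2 (the labels of
   [pb qb, pb) and [pb, 1) exchanged) if [sw] is true. *)
Definition label (R : realType) (p : R) (sw : bool) (x : R) : bool :=
  let pb := 1 - p in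
  let qb := 1 - p / (1 - p) in
  if sw then pb * qb <= x < pb else pb <= x < 1.

(* A set of possible messages is listed in increasing order; expanding it to
   the unit interval sends the element of index k to k / (size A). *)
Definition point (R : realType) (K : nat) (A : seq 'I_K) (m : 'I_K) : R :=
  (index m A)%:R / (size A)%:R.

(* The information shared by the encoder and the decoder: the possible
   messages, whether the current labelling is L_2, and whether the next
   transmission is the dummy '0' that follows a received '1'. *)
Record state (K : nat) : Type := State {
  possible : seq 'I_K;
  swapped : bool;
  padding : bool
}.

Definition stopped (K : nat) (st : state K) : bool :=
  (size (possible st) <= 1)%N && ~~ padding st.

(* A round starts with L_1 whenever eps > 0.  Without erasures the labels are
   never exchanged, and a set on which L_1 is constantly '0' could never shrink
   (for eps = 0 this happens to a set of two messages, placed at 0 and 1/2,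
   because the maximizer satisfies 1/2 < 1 - p); so, for eps = 0 only, such a
   set is labelled by L_2. *)
Definition initial_label (R : realType) (eps p : R) (K : nat)
    (A : seq 'I_K) : bool :=
  (eps == 0) && all (fun m => ~~ label p false (point R A m)) A.

Definition begin_round (R : realType) (eps p : R) (K : nat) (A : seq 'I_K)
    (pad : bool) : state K :=
  State A (initial_label eps p A) pad.

Definition step (R : realType) (eps p : R) (K : nat) (st : state K)
    (y : output) : state K :=
  let: State A sw pad := st in
  if stopped st then st
  else if pad then State A sw false
  else if y is Some b then
    begin_round eps p [seq m <- A | label p sw (point R A m) == b] b
  else State A (~~ sw) false.

Definition run (R : realType) (eps p : R) (K : nat) (ys : seq output)
    : state K :=
  foldl (@step R eps p K) (begin_round eps p (enum 'I_K) false) ys.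

(* A '0' is sent as padding and after the procedure has stopped.  The test
   [m \in possible st] fails only after outputs of probability zero. *)
Definition scheme_enc (R : realType) (eps p : R) (K : nat) (m : 'I_K)
    (ys : seq output) : bool :=
  let st := run eps p K ys in
  [&& ~~ stopped st, ~~ padding st, m \in possible st
    & label p (swapped st) (point R (possible st) m)].

Definition scheme_dec (R : realType) (eps p : R) (K : nat) (ys : seq output)
    : option 'I_K :=
  if possible (run eps p K ys) is [:: m] then Some m else None.

Lemma scheme_no_consecutive_ones (R : realType) (eps p : R) (K : nat)
    (m : 'I_K) (s : seq output) (y : output) :
  scheme_enc eps p m s -> ~~ scheme_enc eps p m (rcons s y).
Proof.
rewrite /scheme_enc /run foldl_rcons -/(run eps p K s).
case: (run eps p K s) => A sw pad /and4P[nstop /= npad mS lab].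
rewrite (negbTE nstop) (negbTE npad).
case: y => [[]|] /=.
- by rewrite andbF.
- by rewrite mem_filter lab /= !andbF.
- suff /negbTE-> : ~~ label p (~~ sw) (point R A m) by rewrite !andbF.
  case: sw lab {nstop} => /= /andP[lo hi]; first by rewrite leNgt hi.
  by rewrite negb_and -leNgt lo orbT.
Qed.

(* The scheme cut after n channel uses; the first message is announced if more
   than one message is still possible. *)
Definition scheme_code (R : realType) (eps p : R) (n K : nat)
    (K_gt0 : (0 < K)%N) : fb_code n K :=
  @FbCode n K (@scheme_enc R eps p K)
    (fun ys => odflt (Ordinal K_gt0) (scheme_dec eps p K ys))
    (fun m s y _ => @scheme_no_consecutive_ones R eps p K m s y).

(* Pr(T = n), where T is the number of channel uses after which the procedure
   stops, for a message uniform on K values. *)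
Definition stop_time_prob (R : realType) (eps p : R) (K n : nat) : R :=
  K%:R^-1 * \sum_(m < K) \sum_(ys : n.-tuple output |
      stopped (run eps p K ys) &&
      [forall i : 'I_n, ~~ stopped (run eps p K (take i ys))])
    output_prob eps (scheme_enc eps p m) ys.

Definition expected_stop_time (R : realType) (eps p : R) (K : nat) : \bar R :=
  (\sum_(0 <= n <oo) (n%:R * stop_time_prob eps p K n)%:E)%E.

(* Main.v *)
(* Write c = 1 / (1 - eps).  Let p solve (1 - p)^(c + 1) = p^c and let C be
   defined by 1 - p = 2^(-C c); then p = 2^(-C (c + 1)), and Gibbs' inequality
   H_b(x) <= - x log p - (1 - x) log (1 - p) = C (x + c) shows that p is the only
   maximizer and that C is the maximum.  A received '0' takes c channel uses on
   average, a received '1' takes c + 1 uses with the dummy '0' after it: both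
   carry C bits per use.

   Converse: compare the output law given any message with the law of i.i.d.
   Bernoulli(p) inputs that are reset to 0 after each received '1'.  The relative
   entropy is at most C (n + 1), because the extra cost of a received '1' is paid
   by the following use, which carries no information.

   Scheme: a set of k messages is split into sets of sizes k p + O(1) and
   k (1 - p) + O(1), so that log2 k / C decreases by the elapsed time on average,
   up to an error O(1 / k) which is absorbed by subtracting D / k from the
   potential.  The potential plus the time is then a supermartingale with bounded
   increments; its expectation bounds the expected stopping time, and its
   exponential moments bound the tail. *)

Require Import Defs.
From HB Require Import structures.
From mathcomp Require Import all_boot all_order all_algebra.
From mathcomp Require Import all_classical all_reals all_analysis.
From mathcomp Require Import ring lra zify.

Set Implicit Arguments.
Unset Strict Implicit.
Unset Printing Implicit Defensive.

Import Order.TTheory GRing.Theory Num.Theory.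
Import numFieldNormedType.Exports.

Local Open Scope classical_set_scope.
Local Open Scope ring_scope.

(** * Gibbs' inequality and the maximizer of the rate *)

(** This is [ln t <= t - 1] at [t = y / x], scaled by [x]. Summed over two measures of equal mass,
    the right-hand sides cancel and Gibbs' inequality remains. *)
Lemma mul_ln_subl_le (R : realType) (x y : R) :
  0 <= x -> 0 < y -> x * (ln y - ln x) <= y - x.
Proof.
rewrite le_eqVlt => /predU1P[<- y0|x0 y0]; first by rewrite mul0r subr0 ltW.
rewrite -ln_div ?posrE// -[y - x](mulfVK (lt0r_neq0 x0)) mulrC.
rewrite ler_pM2r// mulrBl divff ?lt0r_neq0//.
have := @le_ln1Dx R (y / x - 1); rewrite addrCA subrr addr0; apply.
by rewrite ltrBDr addrC subrr divr_gt0.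
Qed.

Lemma mul_ln_subl_lt (R : realType) (x y : R) :
  0 <= x -> 0 < y -> x != y -> x * (ln y - ln x) < y - x.
Proof.
rewrite le_eqVlt => /predU1P[<- y0 _|x0 y0 xy]; first by rewrite mul0r subr0.
have yx0 : 0 < y / x by rewrite divr_gt0.
rewrite -ln_div ?posrE// -[y - x](mulfVK (lt0r_neq0 x0)) mulrC.
rewrite ltr_pM2r// mulrBl divff ?lt0r_neq0//.
have ln_neq0 : ln (y / x) != 0.
  by rewrite ln_eq0// -(inj_eq (mulIf (lt0r_neq0 x0))) mulfVK ?lt0r_neq0// mul1r eq_sym.
by rewrite ltrBrDl; have := expR_gt1Dx ln_neq0; rewrite lnK ?posrE.
Qed.

Lemma ln2_gt0 (R : realType) : 0 < ln 2 :> R.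
Proof. by rewrite ln_gt0// ltr1n. Qed.

Lemma binary_entropy_ln (R : realType) (x : R) :
  binary_entropy x * ln 2 = - x * ln x - (1 - x) * ln (1 - x).
Proof.
rewrite /binary_entropy /log2.
by field; rewrite lt0r_neq0 ?ln2_gt0.
Qed.

Lemma binary_entropy_lt (R : realType) (p x : R) : 0 < p < 1 -> 0 <= x <= 1 ->
  x != p ->
  binary_entropy x * ln 2 < x * - ln p + (1 - x) * - ln (1 - p).
Proof.
move=> /andP[p0 p1] /andP[x0 x1] xp; rewrite binary_entropy_ln.
have := mul_ln_subl_lt x0 p0 xp.
have q0 : 0 < 1 - p by lra.
have y0 : 0 <= 1 - x by lra.
have := mul_ln_subl_le y0 q0; lra.
Qed.

(* [kap] is the capacity in nats: with [c = 1 / (1 - eps)] the expected number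
   of uses per received symbol, a received '0' costs [c] uses and carries
   [kap * c] nats, a received '1' costs [c + 1] uses and carries
   [kap * (c + 1)] nats. *)
Definition balanced (R : realType) (eps p kap : R) : Prop :=
  [/\ 1 / 3 < p < 1 / 2, 0 < kap, (1 - eps) * - ln (1 - p) = kap
    & (1 - eps) * - ln p = kap * (2 - eps)].

(** Eliminating [kap] leaves the single equation [ln p = (2 - eps) * ln (1 - p)], solved by the
    intermediate value theorem. The sign at 1/3 comes from [(2/3)^2 > 1/3]. *)
Lemma balanced_exists (R : realType) (eps : R) : 0 <= eps < 1 ->
  exists p kap, balanced eps p kap.
Proof.
move=> /andP[e0 e1].
pose f x : R := (2 - eps) * ln (1 - x) - ln x.
have ab : (1 / 3 : R) <= 1 / 2 by lra.
have cf : {within `[1 / 3, 1 / 2], continuous f}.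
  apply: continuous_in_subspaceT => x; rewrite inE/= in_itv/= => /andP[x1 x2].
  have c1 : {for x, continuous (fun x : R => ln (1 - x))}.
    apply: (@continuous_comp _ _ _ (fun x : R => 1 - x) (@ln R)).
      by apply: cvgB; [exact: cvg_cst|exact: cvg_id].
    by apply: continuous_ln; lra.
  apply: cvgB; last by apply: continuous_ln; lra.
  by apply: cvgM; [exact: cvg_cst|exact: c1].
have f3 : 0 < f (1 / 3).
  rewrite /f.
  have lt : ln (1 - 1 / 3) < 0 :> R by apply: ln_lt0; lra.
  have : 0 < ln (4 / 3) :> R by apply: ln_gt0; lra.
  have -> : (4 / 3 = (1 - 1 / 3) * ((1 - 1 / 3) / (1 / 3)) :> R) by field.
  rewrite lnM ?posrE ?ln_div ?posrE; [|lra..].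
  have : eps * ln (1 - 1 / 3) <= 0 by rewrite mulr_ge0_le0// ltW.
  lra.
have f2 : f (1 / 2) < 0.
  rewrite /f.
  have lt : ln (1 / 2) < 0 :> R by apply: ln_lt0; lra.
  have -> : (1 - 1 / 2 = 1 / 2 :> R) by field.
  have -> : (2 - eps) * ln (1 / 2) - ln (1 / 2) = (1 - eps) * ln (1 / 2) :> R by ring.
  by rewrite nmulr_llt0// subr_gt0.
have [|p pab fp] := @IVT R f _ _ 0 ab cf.
  by rewrite ge_min le_max (ltW f2) (ltW f3) orbT.
move: pab; rewrite in_itv/= => /andP[p3 p2].
have p3' : 1 / 3 < p.
  by rewrite lt_neqAle p3 andbT; apply/eqP => pE; rewrite pE fp ltxx in f3.
have p2' : p < 1 / 2.
  by rewrite lt_neqAle p2 andbT; apply/eqP => pE; rewrite -pE fp ltxx in f2.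
exists p, ((1 - eps) * - ln (1 - p)); split => //.
- by rewrite p3' p2'.
- by rewrite mulr_gt0 ?subr_gt0// oppr_gt0 ln_lt0//; lra.
- move: fp; rewrite /f => /eqP; rewrite subr_eq0 => /eqP <-; ring.
Qed.

Lemma balanced_ln (R : realType) (eps p kap : R) : eps < 1 ->
  balanced eps p kap ->
  - ln (1 - p) = kap * (1 / (1 - eps)) /\ - ln p = kap * (1 / (1 - eps) + 1).
Proof.
move=> e1 [_ _ E0 E1]; have d0 : 1 - eps != 0 by rewrite lt0r_neq0// subr_gt0.
split; apply: (mulfI d0); first by rewrite E0; field.
by rewrite E1; field.
Qed.

(** The cross-entropy of [x] relative to a balanced [p] is [kap * (x + 1 / (1 - eps))] in nats, a
    multiple of the denominator of [rate_fun]. Strictness in Gibbs' inequality makes the maximizer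
    unique. *)
Lemma rate_fun_lt_balanced (R : realType) (eps p kap x : R) :
  0 <= eps < 1 -> balanced eps p kap -> 0 <= x <= 1 / 2 -> x != p ->
  rate_fun eps x < kap / ln 2.
Proof.
move=> /andP[e0 e1] bal x01 xp; have [l0 l1] := balanced_ln e1 bal.
case: bal => pP k0 _ _; rewrite /rate_fun lt_eqF//.
have c0 : 0 < 1 / (1 - eps) by rewrite divr_gt0// subr_gt0.
have d0 : 0 < x + 1 / (1 - eps) by lra.
rewrite ltr_pdivrMr// -(ltr_pM2r (ln2_gt0 R)).
have x1 : 0 <= x <= 1 by lra.
have p1 : 0 < p < 1 by lra.
have := binary_entropy_lt p1 x1 xp; rewrite l0 l1 => /lt_le_trans; apply.
rewrite le_eqVlt; apply/orP; left; apply/eqP.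
by field; rewrite !lt0r_neq0 ?ln2_gt0// subr_gt0.
Qed.

Lemma rate_fun_balanced (R : realType) (eps p kap : R) :
  0 <= eps < 1 -> balanced eps p kap -> rate_fun eps p = kap / ln 2.
Proof.
move=> /andP[e0 e1] bal; have [l0 l1] := balanced_ln e1 bal.
case: bal => pP k0 _ _; rewrite /rate_fun lt_eqF//.
have c0 : 0 < 1 / (1 - eps) by rewrite divr_gt0// subr_gt0.
have d0 : 0 < p + 1 / (1 - eps) by lra.
apply: (mulIf (lt0r_neq0 d0)); rewrite mulfVK ?lt0r_neq0//.
apply: (mulIf (lt0r_neq0 (ln2_gt0 R))); rewrite binary_entropy_ln.
have -> : - p * ln p - (1 - p) * ln (1 - p) = p * - ln p + (1 - p) * - ln (1 - p).
  by ring.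
by rewrite l0 l1; field; rewrite !lt0r_neq0 ?ln2_gt0// subr_gt0.
Qed.

Lemma balanced_maximizer (R : realType) (eps p kap : R) :
  0 <= eps < 1 -> balanced eps p kap -> is_maximizer eps p.
Proof.
move=> eP bal; split=> [|x xP]; first by case: bal => ? _ _ _; lra.
rewrite (rate_fun_balanced eP bal); have [->|xp] := eqVneq x p.
  by rewrite (rate_fun_balanced eP bal).
exact/ltW/(rate_fun_lt_balanced eP bal).
Qed.

(** By uniqueness, an arbitrary maximizer is the balanced point, so it satisfies the two logarithmic
    equations. *)
Lemma maximizer_balanced (R : realType) (eps p : R) :
  0 <= eps < 1 -> is_maximizer eps p -> exists kap, balanced eps p kap.
Proof.
move=> eP [pP pmax]; have [p0 [kap bal]] := balanced_exists eP.
exists kap; have [<-//|] := eqVneq p0 p; rewrite eq_sym => pp0.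
have := rate_fun_lt_balanced eP bal pP pp0; rewrite -(rate_fun_balanced eP bal).
by rewrite ltNge pmax//; case: bal => ? _ _ _; lra.
Qed.

(** * Sums over output sequences *)

Lemma sum_tuple0 (R : nmodType) (T : finType) (f : seq T -> R) :
  \sum_(t : 0.-tuple T) f t = f [::].
Proof.
rewrite (bigD1 [tuple])//= big1 ?addr0// => t /negP[]; apply/eqP; exact: tuple0.
Qed.

Lemma sum_tupleS (R : nmodType) (T : finType) (n : nat) (f : seq T -> R) :
  \sum_(t : n.+1.-tuple T) f t = \sum_x \sum_(t : n.-tuple T) f (x :: t).
Proof.
rewrite pair_big/= (reindex (fun xt : T * n.-tuple T => [tuple of xt.1 :: xt.2]))//=.
exists (fun t : n.+1.-tuple T => (thead t, [tuple of behead t])) => [[x t] _|t _].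
  by rewrite /= theadE; congr pair; apply: val_inj.
by rewrite -tuple_eta.
Qed.

Lemma sum_output (R : nmodType) (f : output -> R) :
  \sum_y f y = f None + (f (Some true) + f (Some false)).
Proof.
rewrite (bigD1 None)//= (bigD1 (Some true))//= (bigD1 (Some false))//=.
by rewrite big1 ?addr0// => -[[]|].
Qed.

Lemma bec_ge0 (R : realType) (eps : R) x y : 0 <= eps <= 1 -> 0 <= bec eps x y.
Proof.
by move=> /andP[e0 e1]; case: y => [b|//] /=; case: eqP => // _; rewrite subr_ge0.
Qed.

Lemma sum_bec (R : realType) (eps : R) (x : bool) (f : output -> R) :
  \sum_y bec eps x y * f y = eps * f None + (1 - eps) * f (Some x).
Proof.
by rewrite sum_output /=; case: x => /=; rewrite mul0r ?addr0 ?add0r.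
Qed.

Lemma output_prob_nil (R : realType) (eps : R) e : output_prob eps e [::] = 1.
Proof. by rewrite /output_prob big_ord0. Qed.

Lemma output_prob_cons (R : realType) (eps : R) e y ys :
  output_prob eps e (y :: ys) =
  bec eps (e [::]) y * output_prob eps (fun s => e (y :: s)) ys.
Proof. by rewrite /output_prob /= big_ord_recl. Qed.

Lemma output_prob_ge0 (R : realType) (eps : R) e ys : 0 <= eps <= 1 ->
  0 <= output_prob eps e ys.
Proof. by move=> eP; apply: prodr_ge0 => i _; exact: bec_ge0. Qed.

(** Conditioning on the first output: it is the erasure or the input itself. The later inductions on
    the number of channel uses rest on this recursion. *)
Lemma sum_output_prob_cons (R : realType) (eps : R) e n (f : seq output -> R) :
  \sum_(ys : n.+1.-tuple output) output_prob eps e ys * f ys =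
  eps * (\sum_(ys : n.-tuple output)
           output_prob eps (fun s => e (None :: s)) ys * f (None :: ys)) +
  (1 - eps) * (\sum_(ys : n.-tuple output)
           output_prob eps (fun s => e (Some (e [::]) :: s)) ys *
             f (Some (e [::]) :: ys)).
Proof.
rewrite (sum_tupleS n (fun ys => output_prob eps e ys * f ys)).
under eq_bigr => y _.
  under eq_bigr => ys _ do rewrite output_prob_cons -mulrA.
  rewrite -mulr_sumr; over.
exact: (sum_bec eps (e [::]) (fun y => \sum_(ys : n.-tuple output)
  output_prob eps (fun s => e (y :: s)) ys * f (y :: ys))).
Qed.

Lemma sum_output_prob (R : realType) (eps : R) e n :
  \sum_(ys : n.-tuple output) output_prob eps e ys = 1.
Proof.
elim: n e => [|n IH] e.
  by rewrite (sum_tuple0 (output_prob eps e)) output_prob_nil.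
under eq_bigr do rewrite -[output_prob _ _ _]mulr1.
rewrite (sum_output_prob_cons eps e n (fun=> 1)).
by rewrite -!mulr_suml !IH; ring.
Qed.

(** * Upper bound on the capacity *)

(* The product [ref_erasures eps ys * ref_symbols p false ys] is the probability
   of [ys] when the input is 1 with probability [p] independently of the past,
   except that it is 0 right after a received 1 ([forced]). *)
Fixpoint ref_erasures (R : realType) (eps : R) (ys : seq output) : R :=
  if ys is y :: ys' then
    (if y is None then eps else 1 - eps) * ref_erasures eps ys'
  else 1.

Fixpoint ref_symbols (R : realType) (p : R) (forced : bool) (ys : seq output) : R :=
  match ys with
  | [::] => 1
  | None :: ys' => ref_symbols p false ys'
  | Some b :: ys' =>
      (if forced then (~~ b)%:R else if b then p else 1 - p) * ref_symbols p b ys'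
  end.

Lemma ref_erasures_ge0 (R : realType) (eps : R) ys : 0 <= eps <= 1 ->
  0 <= ref_erasures eps ys.
Proof.
move=> /andP[e0 e1]; elim: ys => //= -[b|] ys IH; rewrite mulr_ge0// subr_ge0//.
Qed.

Lemma ref_symbols_ge0 (R : realType) (p : R) b ys : 0 <= p <= 1 ->
  0 <= ref_symbols p b ys.
Proof.
move=> /andP[p0 p1]; elim: ys b => //= -[b'|] ys IH b; rewrite ?mulr_ge0//.
by case: b => //; case: b'; rewrite ?subr_ge0.
Qed.

Lemma sum_ref (R : realType) (eps p : R) n forced :
  \sum_(ys : n.-tuple output) ref_erasures eps ys * ref_symbols p forced ys = 1.
Proof.
elim: n forced => [|n IH] forced.
  by rewrite (sum_tuple0 (fun ys => ref_erasures eps ys * ref_symbols p forced ys)) mulr1.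
rewrite (sum_tupleS n (fun ys => ref_erasures eps ys * ref_symbols p forced ys)).
under eq_bigr => y _.
  under eq_bigr => ys _ do rewrite /= -mulrA.
  rewrite -mulr_sumr; over.
rewrite sum_output /= IH.
under eq_bigr => ys _ do rewrite mulrCA.
under [in X in _ + (_ + X)]eq_bigr => ys _ do rewrite mulrCA.
by rewrite -!mulr_sumr !IH; case: forced => /=; ring.
Qed.

(** A form of the input constraint that is stable under fixing the first output; [forced] means that
    a 1 was just received. After an erasure the flag is dropped even if a 1 was sent, because the
    reference law sees only the outputs. *)
Definition constrained (n : nat) (forced : bool) (e : seq output -> bool) : Prop :=
  (forced -> (0 < n)%N -> ~~ e [::]) /\
  forall s y, ((size s).+1 < n)%N -> e s -> ~~ e (rcons s y).

Lemma constrained_erasure n forced e : constrained n.+1 forced e ->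
  constrained n false (fun s => e (None :: s)).
Proof.
move=> [_ H]; split=> // s y sn; rewrite -rcons_cons; exact: H.
Qed.

Lemma constrained_received n forced e : constrained n.+1 forced e ->
  constrained n (e [::]) (fun s => e (Some (e [::]) :: s)).
Proof.
move=> [_ H]; split=> [e0 n0|s y sn]; first by apply: (H [::]).
rewrite -rcons_cons; exact: H.
Qed.

(** With feedback the inputs are determined by the message and the past outputs, so only the erasure
    pattern is random. The likelihood ratio to the reference law is therefore [1 / ref_symbols],
    which is finite because the constraint is respected. *)
Lemma output_prob_ref (R : realType) (eps p : R) n forced e (ys : seq output) :
  0 < p < 1 -> size ys = n -> constrained n forced e ->
  output_prob eps e ys != 0 ->
  output_prob eps e ys = ref_erasures eps ys /\ 0 < ref_symbols p forced ys.
Proof.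
move=> /andP[p0 p1]; elim: ys n forced e => [|y ys IH] [|n] forced e //=.
  by rewrite output_prob_nil.
move=> [] sn cst; rewrite output_prob_cons mulf_eq0 negb_or => /andP[].
case: y => [b|] /=.
  case: (b =P e [::]) => [->|_]; last by rewrite eqxx.
  move=> _ P0.
  have [-> L0] := IH _ _ _ sn (constrained_received cst) P0; split => //.
  rewrite mulr_gt0//; case: forced cst => [[/(_ isT isT)/negbTE -> //]|_].
  by case: (e [::]) => //; rewrite subr_gt0.
by move=> _ P0; have [-> L0] := IH _ _ _ sn (constrained_erasure cst) P0.
Qed.

(* An erasure costs nothing, and [balanced] makes both inputs equally expensive
   once a sent 1 is credited with the useless transmission that follows it. *)
Lemma ref_divergence_le (R : realType) (eps p kap : R) n forced e :
  0 <= eps <= 1 -> 0 < p < 1 -> (1 - eps) * - ln (1 - p) <= kap ->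
  (1 - eps) * - ln p <= kap * (2 - eps) -> constrained n forced e ->
  \sum_(ys : n.-tuple output) output_prob eps e ys * - ln (ref_symbols p forced ys)
    <= kap * (n.+1%:R - forced%:R).
Proof.
move=> eP pP k0 k1; have kap0 : 0 <= kap.
  apply: le_trans k0; rewrite mulr_ge0//; first by lra.
  by rewrite oppr_ge0 ltW// ln_lt0//; lra.
elim: n forced e => [|n IH] forced e cst.
  rewrite (sum_tuple0 (fun ys => output_prob eps e ys * - ln (ref_symbols p forced ys))).
  by rewrite ln1 oppr0 mulr0 mulr_ge0//; case: forced {cst}; rewrite ?subrr ?subr0.
rewrite (sum_output_prob_cons eps e n (fun ys => - ln (ref_symbols p forced ys))) /=.
set x := e [::].
set g : R := if forced then (~~ x)%:R else if x then p else 1 - p.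
have g0 : 0 < g.
  move: (cst); rewrite /g /x; case: (forced) => [[/(_ isT isT)/negbTE -> //]|_].
  by case: (e [::]); lra.
have -> : \sum_(ys : n.-tuple output)
      output_prob eps (fun s => e (Some x :: s)) ys * - ln (g * ref_symbols p x ys)
    = - ln g + \sum_(ys : n.-tuple output)
      output_prob eps (fun s => e (Some x :: s)) ys * - ln (ref_symbols p x ys).
  rewrite -[X in X + _]mul1r -(sum_output_prob eps (fun s => e (Some x :: s)) n).
  rewrite mulr_suml -big_split; apply: eq_bigr => ys _ /=.
  have [->|P0] := eqVneq (output_prob eps (fun s => e (Some x :: s)) ys) 0.
    by rewrite !mul0r addr0.
  have [_ L0] := output_prob_ref pP (size_tuple ys) (constrained_received cst) P0.
  by rewrite lnM ?posrE//; ring.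
have IH0 := IH _ _ (constrained_erasure cst).
have IH1 := IH _ _ (constrained_received cst).
have e0 : 0 <= eps by lra.
have e1 : 0 <= 1 - eps by lra.
have {IH0} := ler_wpM2l e0 IH0; have {IH1} := ler_wpM2l e1 IH1; rewrite -/x.
have : (1 - eps) * - ln g <= kap * (1 + (1 - eps) * x%:R - forced%:R).
  move: (cst); rewrite /g /x; case: (forced) => [[/(_ isT isT)/negbTE -> _]|_] /=.
    by rewrite ln1; lra.
  by case: (e [::]) => /=; lra.
rewrite -[n.+2%:R]natr1 mulr0n subr0; lra.
Qed.

(** Gibbs' inequality is summed over pairs (message, output); both measures have mass [K], so the
    masses cancel. The conditions on [kap] are inequalities so that [eps = 1] with [kap = 0] is
    covered as well. *)
Lemma converse (R : realType) (eps p kap : R) n K (c : fb_code n K) :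
  0 <= eps <= 1 -> 0 < p < 1 -> (1 - eps) * - ln (1 - p) <= kap ->
  (1 - eps) * - ln p <= kap * (2 - eps) -> (0 < K)%N ->
  (1 - error_prob eps c) * ln K%:R <= kap * n.+1%:R + ln 2.
Proof.
move=> eP pP k0 k1 K0; have Kr : 0 < K%:R :> R by rewrite ltr0n.
pose P m ys := output_prob eps (enc c m) ys.
pose L ys := ref_symbols p false ys.
pose Q ys := ref_erasures eps ys * L ys.
(* Fano's inequality is obtained by comparing the law of (message, output) with
   the product of [Q] and an equal mixture of the decoded and a uniform
   message. *)
pose g (ys : n.-tuple output) m : R := (K%:R * (dec c ys == m)%:R + 1) / 2.
have g0 ys m : 0 < g ys m.
  by rewrite divr_gt0// ltr_wpDl// mulr_ge0.
have cst m : constrained n false (enc c m).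
  by split=> // s y sn; exact: no_consecutive_ones.
have Q0 ys : 0 <= Q ys by rewrite mulr_ge0 ?ref_erasures_ge0 ?ref_symbols_ge0//; lra.
have gibbs (m : 'I_K) (ys : n.-tuple output) : P m ys - Q ys * g ys m
   + P m ys * ((dec c ys == m)%:R * ln K%:R - ln 2) <= P m ys * - ln (L ys).
  have [->|P0] := eqVneq (P m ys) 0.
    by rewrite !mul0r addr0 sub0r oppr_le0 mulr_ge0// ltW.
  have [PE L0] := output_prob_ref pP (size_tuple ys) (cst m) P0.
  have P_gt0 : 0 < P m ys by rewrite lt_neqAle eq_sym P0 output_prob_ge0.
  have b0 : 0 < ref_erasures eps ys by rewrite -PE.
  have Qg : 0 < Q ys * g ys m by rewrite mulr_gt0// mulr_gt0.
  have := mul_ln_subl_le (ltW P_gt0) Qg.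
  have -> : ln (Q ys * g ys m) = ln (P m ys) + ln (L ys) + ln (g ys m).
    by rewrite /P PE -lnM ?posrE// -lnM ?posrE// mulr_gt0.
  (* A correctly decoded message has weight [(K + 1) / 2], any other 1/2. *)
  have : (dec c ys == m)%:R * ln K%:R - ln 2 <= ln (g ys m).
    rewrite /g ln_div ?posrE// ?ltr_wpDl ?mulr_ge0// lerB//.
    case: (_ == m); rewrite /= ?mul1r ?mulr1 ?mul0r ?mulr0 ?add0r ?ln1//.
    by rewrite ler_ln ?posrE ?ltr_wpDl// lerDl.
  move=> /(ler_wpM2l (ltW P_gt0)); lra.
have sP m : \sum_(ys : n.-tuple output) P m ys = 1 by exact: sum_output_prob.
have main : \sum_(m < K) \sum_(ys : n.-tuple output) (P m ys - Q ys * g ys m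
   + P m ys * ((dec c ys == m)%:R * ln K%:R - ln 2)) <= K%:R * (kap * n.+1%:R).
  apply: (@le_trans _ _ (\sum_(m < K) kap * n.+1%:R)).
    apply: ler_sum => m _.
    apply: le_trans (_ : \sum_(ys : n.-tuple output) P m ys * - ln (L ys) <= _).
      by apply: ler_sum => ys _; exact: gibbs.
    by have := ref_divergence_le eP pP k0 k1 (cst m); rewrite subr0.
  by rewrite sumr_const card_ord mulr_natl.
have corr m : \sum_(ys : n.-tuple output) P m ys * (dec c ys == m)%:R
    = 1 - \sum_(ys : n.-tuple output | dec c ys != m) P m ys.
  apply: (addIr (\sum_(ys : n.-tuple output | dec c ys != m) P m ys)).
  rewrite subrK -[RHS](sP m) [RHS](bigID (fun ys : n.-tuple output => dec c ys == m)) /=.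
  congr (_ + _); rewrite (bigID (fun ys : n.-tuple output => dec c ys == m)) /=.
  rewrite [X in _ + X]big1 ?addr0.
    by apply: eq_bigr => ys ->; rewrite mulr1.
  by move=> ys /negbTE ->; rewrite mulr0.
have sQ : \sum_(m < K) \sum_(ys : n.-tuple output) Q ys * g ys m = K%:R.
  rewrite exchange_big /= -[RHS]mul1r -[X in _ = X * _](sum_ref eps p n false) mulr_suml.
  apply: eq_bigr => ys _; rewrite -mulr_sumr; congr (_ * _).
  rewrite /g -mulr_suml big_split /= -mulr_sumr sumr_const card_ord.
  rewrite (bigD1 (dec c ys))//= eqxx big1 ?addr0 => [|m]; last first.
    by rewrite eq_sym => /negbTE ->.
  by rewrite /=; field.
have inner m : \sum_(ys : n.-tuple output) (P m ys - Q ys * g ys m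
   + P m ys * ((dec c ys == m)%:R * ln K%:R - ln 2))
   = 1 - \sum_(ys : n.-tuple output) Q ys * g ys m
     + ((1 - \sum_(ys : n.-tuple output | dec c ys != m) P m ys) * ln K%:R - ln 2).
  rewrite big_split sumrB sP /=; congr (_ + _); rewrite -corr mulr_suml.
  rewrite -[in RHS](mul1r (ln 2)) -[X in _ - X * _](sP m) mulr_suml -sumrB.
  by apply: eq_bigr => ys _; ring.
move: main; rewrite (eq_bigr _ (fun m _ => inner m)).
rewrite big_split sumrB /= sQ sumrB -mulr_suml sumrB !sumr_const card_ord.
have -> : \sum_(m < K) \sum_(ys : n.-tuple output | dec c ys != m) P m ys
  = K%:R * error_prob eps c.
  by rewrite /error_prob mulrA divff ?mul1r// lt0r_neq0.
rewrite -[_ *+ K]mulr_natl => main.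
rewrite -(ler_pM2l Kr); move: main; lra.
Qed.

(** * Dynamics of the scheme *)

(** [scheme_enc] started from an arbitrary state. Prefixing an output amounts by computation to one
    [step], so inductions can run over states. *)
Definition enc_from (R : realType) (eps p : R) (K : nat) (st : state K) (m : 'I_K)
    (ys : seq output) : bool :=
  let st' := foldl (@step R eps p K) st ys in
  [&& ~~ stopped st', ~~ padding st', m \in possible st'
    & label p (swapped st') (Defs.point R (possible st') m)].

Definition refine (R : realType) (p : R) (K : nat) (A : seq 'I_K) (sw b : bool) :
    seq 'I_K :=
  [seq m <- A | label p sw (Defs.point R A m) == b].

Lemma step_stopped (R : realType) (eps p : R) K (st : state K) y :
  stopped st -> step eps p st y = st.
Proof. by case: st => A sw pad /= ->. Qed.

Lemma foldl_stopped (R : realType) (eps p : R) K (st : state K) ys :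
  stopped st -> foldl (@step R eps p K) st ys = st.
Proof.
by move=> st0; elim: ys => //= y ys IH; rewrite step_stopped.
Qed.

Lemma step_none (R : realType) (eps p : R) K (A : seq 'I_K) sw :
  ~~ stopped (State A sw false) ->
  step eps p (State A sw false) None = State A (~~ sw) false.
Proof. by rewrite /step => /negbTE ->. Qed.

Lemma step_some (R : realType) (eps p : R) K (A : seq 'I_K) sw b :
  ~~ stopped (State A sw false) ->
  step eps p (State A sw false) (Some b) = begin_round eps p (refine p A sw b) b.
Proof. by rewrite /step => /negbTE ->. Qed.

Lemma step_padding (R : realType) (eps p : R) K (A : seq 'I_K) sw y :
  step eps p (State A sw true) y = State A sw false.
Proof. by rewrite /step /stopped andbF. Qed.

Lemma enc_from_nil (R : realType) (eps p : R) K (A : seq 'I_K) sw m :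
  ~~ stopped (State A sw false) -> m \in A ->
  enc_from eps p (State A sw false) m [::] = label p sw (Defs.point R A m).
Proof. by rewrite /enc_from /= => -> ->. Qed.

Lemma possible_foldl (R : realType) (eps p : R) K (st : state K) m ys :
  m \in possible st -> output_prob eps (enc_from eps p st m) ys != 0 ->
  m \in possible (foldl (@step R eps p K) st ys).
Proof.
elim: ys st => //= y ys IH st mst.
rewrite output_prob_cons mulf_eq0 negb_or => /andP[bec0 P0]; apply: IH => //.
have [st0|st0] := boolP (stopped st); first by rewrite step_stopped.
case: st st0 mst bec0 {P0} => A sw [] st0 mA; first by rewrite step_padding.
case: y => [b|]; last by rewrite step_none.
rewrite step_some// enc_from_nil//= mem_filter mA andbT.
by case: (b =P _) => [->|_]; rewrite eqxx.
Qed.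

Lemma zero_error (R : realType) (eps p : R) K (m : 'I_K) ys :
  output_prob eps (scheme_enc eps p m) ys != 0 -> stopped (run eps p K ys) ->
  scheme_dec eps p K ys = Some m.
Proof.
move=> /possible_foldl; rewrite mem_enum => /(_ isT); rewrite /scheme_dec /run.
case: (foldl _ _ _) => [[|m' []] sw pad] //=.
by rewrite inE => /eqP ->.
Qed.

(** This is Pr(T > n) for the stopping time T from [st], given the message [m]. *)
Definition survival (R : realType) (eps p : R) (K n : nat) (st : state K) (m : 'I_K)
    : R :=
  \sum_(ys : n.-tuple output) output_prob eps (enc_from eps p st m) ys *
    (~~ stopped (foldl (@step R eps p K) st ys))%:R.

Lemma survival0 (R : realType) (eps p : R) K (st : state K) m :
  survival eps p 0 st m = (~~ stopped st)%:R.
Proof.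
rewrite /survival (sum_tuple0 (fun ys => output_prob eps (enc_from eps p st m) ys *
    (~~ stopped (foldl (@step R eps p K) st ys))%:R)).
by rewrite output_prob_nil mul1r.
Qed.

Lemma survivalS (R : realType) (eps p : R) K n (st : state K) m :
  survival eps p n.+1 st m =
  eps * survival eps p n (step eps p st None) m +
  (1 - eps) *
    survival eps p n (step eps p st (Some (enc_from eps p st m [::]))) m.
Proof.
exact: (sum_output_prob_cons eps (enc_from eps p st m) n
  (fun ys => (~~ stopped (foldl (@step R eps p K) st ys))%:R)).
Qed.

Lemma survival_stopped (R : realType) (eps p : R) K n (st : state K) m :
  stopped st -> survival eps p n st m = 0.
Proof.
by move=> st0; apply: big1 => ys _; rewrite foldl_stopped// st0 mulr0.
Qed.

Lemma survival_ge0 (R : realType) (eps p : R) K n (st : state K) m :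
  0 <= eps <= 1 -> 0 <= survival eps p n st m.
Proof. by move=> eP; apply: sumr_ge0 => ys _; rewrite mulr_ge0// output_prob_ge0. Qed.

Fixpoint first_stop (R : realType) (eps p : R) (K : nat) (st : state K)
    (ys : seq output) : bool :=
  if ys is y :: ys' then ~~ stopped st && first_stop eps p (step eps p st y) ys'
  else stopped st.

Lemma first_stopE (R : realType) (eps p : R) K (st : state K) n (ys : n.-tuple output) :
  stopped (foldl (@step R eps p K) st ys) &&
    [forall i : 'I_n, ~~ stopped (foldl (@step R eps p K) st (take i ys))] =
  first_stop eps p st ys.
Proof.
case: ys => ys /= /eqP; elim: ys n st => [|y ys IH] n st /= <-.
  by rewrite (_ : [forall i, _]) ?andbT//; apply/forallP => -[].
rewrite -(IH _ _ erefl) andbCA; congr (_ && _); apply/forallP/andP => [H|[H0 /forallP H] i].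
  by split; [exact: (H ord0)|apply/forallP => i; exact: (H (lift ord0 i))].
by case: (unliftP ord0 i) => [j|] ->; [exact: H|exact: H0].
Qed.

Definition stopping (R : realType) (eps p : R) (K n : nat) (st : state K) (m : 'I_K)
    : R :=
  \sum_(ys : n.-tuple output) output_prob eps (enc_from eps p st m) ys *
    (first_stop eps p st ys)%:R.

Lemma stopping0 (R : realType) (eps p : R) K (st : state K) m :
  stopping eps p 0 st m = (stopped st)%:R.
Proof.
rewrite /stopping (sum_tuple0 (fun ys => output_prob eps (enc_from eps p st m) ys *
    (first_stop eps p st ys)%:R)).
by rewrite output_prob_nil mul1r.
Qed.

Lemma stoppingS (R : realType) (eps p : R) K n (st : state K) m :
  stopping eps p n.+1 st m = (~~ stopped st)%:R *
  (eps * stopping eps p n (step eps p st None) m +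
  (1 - eps) *
    stopping eps p n (step eps p st (Some (enc_from eps p st m [::]))) m).
Proof.
rewrite /stopping (sum_output_prob_cons eps (enc_from eps p st m) n
  (fun ys => (first_stop eps p st ys)%:R)) /=.
have [st0|st0] /= := boolP (stopped st); last by rewrite mul1r.
by rewrite mul0r !big1 ?mulr0 ?addr0// => ys _; rewrite mulr0.
Qed.

(** Stopped states are absorbing, so stopping exactly at use [n + 1] is the difference of two nested
    survival events. *)
Lemma stopping_survival (R : realType) (eps p : R) K n (st : state K) m :
  stopping eps p n.+1 st m = survival eps p n st m - survival eps p n.+1 st m.
Proof.
elim: n st => [|n IH] st; rewrite stoppingS survivalS.
  rewrite !stopping0 !survival0.
  have [st0|st0] := boolP (stopped st); first by rewrite !step_stopped// st0 /=; ring.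
  by case: (stopped _); case: (stopped _) => /=; ring.
have [st0|st0] := boolP (stopped st).
  by rewrite !survival_stopped ?step_stopped//=; ring.
by rewrite !IH [survival _ _ n.+2 _ _]survivalS /=; ring.
Qed.

(** A sum over the possible messages and not an average, so that the two parts of a split simply add
    up, without division by set sizes. *)
Definition total_survival (R : realType) (eps p : R) (K n : nat) (st : state K) : R :=
  \sum_(m <- possible st) survival eps p n st m.

Lemma total_survival_ge0 (R : realType) (eps p : R) K n (st : state K) :
  0 <= eps <= 1 -> 0 <= total_survival eps p n st.
Proof. by move=> eP; apply: sumr_ge0 => m _; exact: survival_ge0. Qed.

Lemma total_survival0 (R : realType) (eps p : R) K (st : state K) :
  total_survival eps p 0 st = (size (possible st))%:R * (~~ stopped st)%:R.
Proof.
rewrite /total_survival; under eq_bigr do rewrite survival0.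
by rewrite big_const_seq count_predT iter_addr_0 mulr_natl.
Qed.

Lemma total_survival_stopped (R : realType) (eps p : R) K n (st : state K) :
  stopped st -> total_survival eps p n st = 0.
Proof. by move=> st0; apply: big1 => m _; exact: survival_stopped. Qed.

Lemma total_survival_empty (R : realType) (eps p : R) K n (st : state K) :
  possible st = [::] -> total_survival eps p n st = 0.
Proof. by rewrite /total_survival => ->; rewrite big_nil. Qed.

(** An unerased output sends each message to the part bearing its own label; summed over all
    messages, both parts thus appear with the full weight [1 - eps]. *)
Lemma total_survivalS (R : realType) (eps p : R) K n (A : seq 'I_K) sw :
  ~~ stopped (State A sw false) ->
  total_survival eps p n.+1 (State A sw false) =
  eps * total_survival eps p n (State A (~~ sw) false) +
  (1 - eps) * (total_survival eps p n (begin_round eps p (refine p A sw false) false) +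
               total_survival eps p n (begin_round eps p (refine p A sw true) true)).
Proof.
move=> st0; rewrite /total_survival /=.
rewrite (eq_big_seq (fun m => eps * survival eps p n (State A (~~ sw) false) m +
  (1 - eps) * survival eps p n (begin_round eps p
    (refine p A sw (label p sw (Defs.point R A m))) (label p sw (Defs.point R A m))) m));
  last first.
  by move=> m mA; rewrite survivalS enc_from_nil// step_none// step_some.
rewrite big_split /= -!mulr_sumr; congr (_ + _ * _).
rewrite (bigID (fun m => label p sw (Defs.point R A m))) /= addrC.
by rewrite /refine !big_filter; congr (_ + _); apply: eq_big => m;
  rewrite ?eqb_id ?eqbF_neg// => /negbTE-> || move=> ->.
Qed.

Lemma total_survival_padding (R : realType) (eps p : R) K n (A : seq 'I_K) sw :
  total_survival eps p n.+1 (State A sw true) = total_survival eps p n (State A sw false).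
Proof.
apply: eq_bigr => m _; rewrite survivalS !step_padding; ring.
Qed.

Lemma size_refine (R : realType) (p : R) K (A : seq 'I_K) sw :
  (size (refine p A sw false) + size (refine p A sw true) = size A)%N.
Proof.
rewrite !size_filter addnC -(count_predC (fun m => label p sw (Defs.point R A m))).
by congr (_ + _)%N; apply: eq_count => m /=; rewrite ?eqb_id ?eqbF_neg.
Qed.

(** * A potential for the expected remaining time *)

Lemma count_iota_itv (a b k : nat) :
  count (fun i => (a <= i < b)%N) (iota 0 k) = (minn b k - a)%N.
Proof.
elim: k => [|k IH]; first by rewrite minn0.
by rewrite -addn1 iotaD count_cat IH /= add0n; case: (ltnP k b); case: (leqP a k) => /=; lia.
Qed.

Lemma nat_ceil (R : realType) (x : R) : 0 <= x ->
  exists a : nat, [/\ x <= a%:R, a%:R < x + 1 & forall i : nat, (x <= i%:R) = (a <= i)%N].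
Proof.
move=> x0; have c0 : 0 <= Num.ceil x by rewrite ceil_ge0; lra.
have cE : Num.ceil x = `|Num.ceil x|%N :> int by rewrite gez0_abs.
have /andP[] := ceil_itv x; rewrite cE intrB /= => H1 H2.
exists `|Num.ceil x|%N; split => // [|i]; first by lra.
by rewrite -[LHS](ceil_le_int x i) cE lez_nat absz_nat.
Qed.

Lemma map_index_uniq (T : eqType) (s : seq T) : uniq s ->
  [seq index x s | x <- s] = iota 0 (size s).
Proof.
case: s => // x0 s us; apply: (@eq_from_nth _ 0%N); rewrite ?size_map ?size_iota// => i i_s.
by rewrite (nth_map x0)// nth_iota// index_uniq.
Qed.

(* Under either labelling the points labelled 1 fill a half-open interval of
   length [p]. *)
Lemma size_refine_true (R : realType) (p : R) K (A : seq 'I_K) sw :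
  1 / 3 < p < 1 / 2 -> uniq A -> (1 < size A)%N ->
  let k1 := (size (refine p A sw true))%:R : R in
  `|k1 - (size A)%:R * p| < 1 /\
  (0 < size (refine p A sw true))%N = (sw || (size A != 2)).
Proof.
move=> pP uA k2; set k := size A; have k_gt1 : 2 <= k%:R :> R by rewrite (ler_nat R 2).
have k0 : 0 < k%:R :> R by lra.
pose lo := if sw then 1 - 2 * p else 1 - p; pose hi := lo + p.
have lab (i : nat) : (i < k)%N ->
    label p sw (i%:R / k%:R) = (k%:R * lo <= i%:R) && ~~ (k%:R * hi <= i%:R).
  move=> ik; rewrite -ltNge /label /hi /lo.
  have -> : (1 - p) * (1 - p / (1 - p)) = 1 - 2 * p by field; lra.
  case: (sw); rewrite ler_pdivlMr// ltr_pdivrMr// ![_ * k%:R]mulrC;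
    congr (_ && (_ < _ * _)); ring.
have lo0 : 0 <= k%:R * lo by rewrite mulr_ge0// /lo; case: (sw); lra.
have hi0 : 0 <= k%:R * hi by rewrite mulr_ge0// /hi /lo; case: (sw); lra.
have [a [a1 a2 aP]] := nat_ceil lo0; have [b [b1 b2 bP]] := nat_ceil hi0.
have bk : (b <= k)%N.
  rewrite -bP ger_pMr// /hi /lo; case: (sw); lra.
have ab : (a <= b)%N.
  by rewrite -aP; apply: le_trans b1; rewrite ler_pM2l// /hi; lra.
have -> : size (refine p A sw true) = (b - a)%N.
  rewrite size_filter -[in RHS](minn_idPl bk) -count_iota_itv -(map_index_uniq uA).
  rewrite count_map; apply: eq_in_count => m mA /=.
  by rewrite eqb_id lab ?index_mem// aP bP -ltnNge.
have d1 : k%:R * hi = k%:R * lo + k%:R * p by rewrite -mulrDr.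
rewrite natrB//; split; first by rewrite ltr_norml; apply/andP; split; lra.
have [kE|kn2] := eqVneq k 2%N; last first.
  (* From three points on, [k * p > 1], so an interval of length [p] cannot miss all multiples of
     [1 / k]. *)
  have k3 : 3 <= k%:R :> R by rewrite (ler_nat R 3) ltn_neqAle eq_sym kn2.
  have kp : 1 < k%:R * p by nra.
  by rewrite orbT subn_gt0 -(ltr_nat R); lra.
(* Two messages sit at 0 and 1/2. As [0 < 1 - 2 * p < 1 / 2 < 1 - p], [L_2] separates them and [L_1]
   does not. *)
have kr : k%:R = 2 :> R by rewrite kE.
rewrite orbF subn_gt0; move: a2 b1 b2 a1; rewrite d1 kr /lo.
case: (sw) => a2 b1 b2 a1.
  have a_lt2 : (a < 2)%N by rewrite -(ltr_nat R); lra.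
  have b_gt1 : (1 < b)%N by rewrite -(ltr_nat R); lra.
  by rewrite (leq_trans a_lt2 b_gt1).
have a_gt1 : (1 < a)%N by rewrite -(ltr_nat R); lra.
by apply/negbTE; rewrite -leqNgt (leq_trans bk)// kE.
Qed.

Definition xlnx (R : realType) (n : nat) : R := n%:R * ln n%:R.

(** The left side is [k0 + k1] times the entropy of the split in nats, the right side the same
    multiple of its cross-entropy relative to [p]. *)
Lemma xlnx_split_le (R : realType) (p : R) (k0 k1 : nat) : 0 < p < 1 ->
  xlnx R (k0 + k1) - (xlnx R k0 + xlnx R k1) <= k0%:R * - ln (1 - p) + k1%:R * - ln p.
Proof.
move=> pP; have [k0E|] := posnP (k0 + k1)%N.
  have [-> ->] : k0 = 0%N /\ k1 = 0%N by split; lia.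
  by rewrite /xlnx; lra.
move: (k0 + k1)%N (natrD R k0 k1) => k kE; rewrite -(ltr_nat R) => k_gt0.
have a0 : 0 < k%:R * (1 - p) by rewrite mulr_gt0//; lra.
have a1 : 0 < k%:R * p by rewrite mulr_gt0//; lra.
have := mul_ln_subl_le (ler0n R k0) a0; have := mul_ln_subl_le (ler0n R k1) a1.
rewrite !lnM ?posrE//; [|lra..].
rewrite /xlnx.
have -> : k%:R * ln k%:R = k0%:R * ln k%:R + k1%:R * ln k%:R :> R by rewrite kE; ring.
by move: kE; lra.
Qed.

(* The relative entropy is bounded by the chi-square distance. *)
Lemma xlnx_split_ge (R : realType) (p : R) (k0 k1 : nat) : 1 / 3 < p < 1 / 2 ->
  (0 < k0)%N -> (0 < k1)%N -> `|k1%:R - (k0 + k1)%:R * p| < 1 ->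
  k0%:R * - ln (1 - p) + k1%:R * - ln p - 3 <=
  xlnx R (k0 + k1) - (xlnx R k0 + xlnx R k1).
Proof.
move=> pP; rewrite -!(ler_nat R 1) => k0_ge1 k1_ge1.
move: (k0 + k1)%N (natrD R k0 k1) => k kE; rewrite ltr_norml => dP.
have k2 : 2 <= k%:R :> R by lra.
have a0 : 0 < k%:R * (1 - p) by rewrite mulr_gt0//; lra.
have a1 : 0 < k%:R * p by rewrite mulr_gt0//; lra.
have H (i : nat) (x : R) : 1 <= i%:R :> R -> 0 < x ->
    i%:R * (ln i%:R - ln x) <= i%:R ^+ 2 / x - i%:R.
  move=> i1 x0; have i0 : 0 < i%:R :> R by lra.
  have y0 : 0 < i%:R ^+ 2 / x by rewrite divr_gt0// exprn_gt0.
  have := mul_ln_subl_le (ltW i0) y0.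
  by rewrite ln_div ?posrE ?exprn_gt0// expr2 lnM ?posrE//; lra.
have := H _ _ k0_ge1 a0; have := H _ _ k1_ge1 a1.
rewrite !lnM ?posrE//; [|lra..].
(* The excess over [k] is [d ^+ 2 / (k * (p * (1 - p)))] with rounding error [|d| < 1]. Since
   [k >= 2] and [p * (1 - p) >= 2 / 9], it is at most 9/4. *)
have : k0%:R ^+ 2 / (k%:R * (1 - p)) + k1%:R ^+ 2 / (k%:R * p) <= k%:R + 3.
  have -> : k0%:R = k%:R - k1%:R :> R by lra.
  have -> : (k%:R - k1%:R) ^+ 2 / (k%:R * (1 - p)) + k1%:R ^+ 2 / (k%:R * p)
    = k%:R + (k1%:R - k%:R * p) ^+ 2 / (k%:R * (p * (1 - p))) :> R.
    by field; rewrite !lt0r_neq0//; lra.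
  have q0 : 2 / 9 <= p * (1 - p).
    have : 0 <= (p - 1 / 3) * (2 / 3 - p) by rewrite mulr_ge0//; lra.
    lra.
  have kq : 4 / 9 <= k%:R * (p * (1 - p)).
    have : 0 <= (k%:R - 2) * (p * (1 - p)) by rewrite mulr_ge0//; lra.
    lra.
  rewrite lerD2l ler_pdivrMr; last by lra.
  have : 0 <= (1 - (k1%:R - k%:R * p)) * (1 + (k1%:R - k%:R * p)).
    by rewrite mulr_ge0//; lra.
  lra.
rewrite /xlnx.
have -> : k%:R * ln k%:R = k0%:R * ln k%:R + k1%:R * ln k%:R :> R by rewrite kE; ring.
by move: kE; lra.
Qed.

Lemma natr_pred (R : pzRingType) (n : nat) : (0 < n)%N -> n.-1%:R = n%:R - 1 :> R.
Proof. by move=> n0; rewrite -subn1 natrB. Qed.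

(* [size (possible st)] times an upper bound on the expected remaining time.
   With exact proportions [p] and [1 - p] the first term would be an equality;
   the second one grows at each split and pays for the rounding; the third one
   accounts for a set of two messages, which [L_1] does not split.  When
   [eps = 0] such a set is never labelled by [L_1], and indeed [2 / eps = 0]. *)
Definition offset (R : realType) (eps kap : R) : R :=
  3 / kap + 4 / eps + 2 / (1 - eps).

Definition potential (R : realType) (eps kap : R) K (st : state K) : R :=
  let: State A sw pad := st in
  xlnx R (size A) / kap + offset eps kap * (size A).-1%:R
    + 2 / eps * ((size A == 2) && ~~ sw)%:R + (size A)%:R * pad%:R.

Definition regular (R : realType) (eps : R) K (st : state K) : Prop :=
  uniq (possible st) /\ (eps = 0 -> size (possible st) = 2 -> swapped st).

Lemma regular_begin_round (R : realType) (eps p : R) K (A : seq 'I_K) pad :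
  1 / 3 < p < 1 / 2 -> uniq A -> regular eps (begin_round eps p A pad).
Proof.
move=> pP uA; split=> //= e0 A2; rewrite /initial_label e0 eqxx /=.
have [|_] := @size_refine_true R p K A false pP uA; first by rewrite A2.
rewrite A2 eqxx /= size_filter -has_count => /negbT; rewrite -all_predC => H.
by apply: sub_all H => m /=; rewrite eqb_id.
Qed.

Lemma refine_uniq (R : realType) (p : R) K (A : seq 'I_K) sw b :
  uniq A -> uniq (refine p A sw b).
Proof. exact: filter_uniq. Qed.

Lemma regular_erasure (R : realType) (eps : R) K (A : seq 'I_K) sw sw' pad pad' :
  eps != 0 -> regular eps (State A sw pad) -> regular eps (State A sw' pad').
Proof. by move=> /eqP e0 [uA _]; split. Qed.

Lemma offset_ge0 (R : realType) (eps kap : R) : 0 <= eps < 1 -> 0 < kap ->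
  0 <= offset eps kap.
Proof. by move=> eP k0; rewrite /offset !addr_ge0// divr_ge0//; lra. Qed.

Lemma xlnx_ge0 (R : realType) n : 0 <= xlnx R n.
Proof.
rewrite /xlnx; case: n => [|n]; first by rewrite mul0r.
by rewrite mulr_ge0// ln_ge0// ler1n.
Qed.

Lemma potential_ge0 (R : realType) (eps kap : R) K (st : state K) :
  0 <= eps < 1 -> 0 < kap -> 0 <= potential eps kap st.
Proof.
move=> eP k0; case: st => A sw pad /=; have := offset_ge0 eP k0 => D0.
have E_ge0 : 0 <= 2 / eps by rewrite divr_ge0//; lra.
have t1 : 0 <= xlnx R (size A) / kap by rewrite divr_ge0 ?xlnx_ge0// ltW.
by rewrite !addr_ge0// mulr_ge0.
Qed.

(** The drift inequality, summed over the messages: the potential falls on average by the elapsed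
    use. A split turns [k - 1] into [(k0 - 1) + (k1 - 1)] and so releases one [offset], which pays
    for the errors. *)
Lemma potential_step (R : realType) (eps p kap : R) K (A : seq 'I_K) sw :
  0 <= eps < 1 -> balanced eps p kap -> regular eps (State A sw false) ->
  ~~ stopped (State A sw false) ->
  (size A)%:R + eps * potential eps kap (State A (~~ sw) false)
   + (1 - eps) * (potential eps kap (begin_round eps p (refine p A sw false) false)
                + potential eps kap (begin_round eps p (refine p A sw true) true))
  <= potential eps kap (State A sw false).
Proof.
move=> /andP[e0 e1] [pP kap0 E0 E1] [uA /= swP]; rewrite /stopped /= andbT -ltnNge => k_gt1.
have eE : eps * (2 / eps) <= 2.
  have [->|en0] := eqVneq eps 0; first by rewrite mul0r.
  by rewrite mulrC mulfVK.
have E_ge0 : 0 <= 2 / eps by rewrite divr_ge0.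
have [] := size_refine_true sw pP uA k_gt1.
have := size_refine p A sw.
set k0 := size (refine p A sw false); set k1 := size (refine p A sw true).
set k := size A in k_gt1 swP * => kE dP; case: posnP => [k1E /esym/negbT|k1_gt0 _].
  (* Two messages under [L_1]: an unerased '0' changes nothing, and only an erasure removes the term
     [2 / eps], an average loss of [eps * (2 / eps) = 2], the size of the set. *)
  rewrite negb_or negbK => /andP[/negbTE swE /eqP k2].
  have en0 : eps != 0 by apply/eqP => /swP/(_ k2); rewrite swE.
  have -> : k0 = k by rewrite -kE k1E addn0.
  rewrite /initial_label (negbTE en0) k1E k2 swE /= /xlnx !mul0r !mulr0 !addr0.
  have -> : eps * (2 * ln 2 / kap + offset eps kap * 1) =
    2 * ln 2 / kap + offset eps kap * 1 -
      (1 - eps) * (2 * ln 2 / kap + offset eps kap * 1) by ring.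
  rewrite mulr1 !mulrDr; have : eps * (2 / eps) = 2 by rewrite mulrC mulfVK.
  lra.
have k0_gt0 : (0 < k0)%N.
  rewrite lt0n; apply/eqP => k0E; move: dP; rewrite -kE k0E add0n ltr_norml => /andP[_].
  have : 2 <= k1%:R :> R.
    by move: kE; rewrite k0E add0n => kE; rewrite (ler_nat R 2) kE.
  move: (k1%:R : R) => x x2 d1.
  have : 0 <= (x - 2) * (1 / 2 - p) by rewrite mulr_ge0//; lra.
  lra.
rewrite -kE in dP; have := xlnx_split_ge pP k0_gt0 k1_gt0 dP; rewrite kE.
have kR : k%:R = k0%:R + k1%:R :> R by rewrite -kE natrD.
rewrite -/k0 -/k1 -/k !natr_pred// ?(ltnW k_gt1)// !mulr0 mulr1 !addr0 => split_ge.
have gain : k%:R + (1 - eps) * k1%:R <= (1 - eps) *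
    ((xlnx R k - (xlnx R k0 + xlnx R k1)) / kap + 3 / kap).
  rewrite -mulrDl mulrA ler_pdivlMr//.
  have -> : (k%:R + (1 - eps) * k1%:R) * kap =
      (1 - eps) * (k0%:R * - ln (1 - p) + k1%:R * - ln p).
    by rewrite kR mulrDr !(mulrCA (1 - eps)) E0 E1; ring.
  by rewrite ler_wpM2l//; lra.
(* The released [offset] covers the rounding loss [3 / kap], a possible term [2 / eps] in each of
   the two parts, and the term of mean at most 2 that appears when an erasure leads from [L_2] back
   to [L_1]. *)
have DE : (1 - eps) * (3 / kap + 2 * (2 / eps)) + 2 = (1 - eps) * offset eps kap.
  by rewrite /offset !mulrDr; congr (_ + _ + _); [ring|field; lra].
have b01 (b : bool) : 0 <= 2 / eps * b%:R <= 2 / eps.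
  by case: b; rewrite ?mulr1 ?mulr0 lexx E_ge0.
have /andP[_ b1] := b01 ((k0 == 2) && ~~ initial_label eps p (refine p A sw false)).
have /andP[_ b2] := b01 ((k1 == 2) && ~~ initial_label eps p (refine p A sw true)).
have /andP[b3 _] := b01 ((k == 2) && ~~ sw).
have /andP[_ b4] := b01 ((k == 2) && ~~ ~~ sw).
have e1' : 0 <= 1 - eps by lra.
have := ler_wpM2l e1' b1; have := ler_wpM2l e1' b2; have := ler_wpM2l e0 b4.
have := mulr_ge0 e1' b3; have := mulr_ge0 e0 b3.
move: gain DE eE; rewrite kR; lra.
Qed.

Lemma stopped_size K (A : seq 'I_K) sw : ~~ stopped (State A sw false) -> (1 < size A)%N.
Proof. by rewrite /stopped /= andbT -ltnNge. Qed.

(** Summed tails are an expected time: iterating the drift inequality bounds them by the initial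
    potential, since the final potential is nonnegative. *)
Lemma total_sum_le (R : realType) (eps p kap : R) K N (st : state K) :
  0 <= eps < 1 -> balanced eps p kap -> regular eps st ->
  \sum_(0 <= j < N) total_survival eps p j st <= potential eps kap st.
Proof.
move=> eP bal; have [pP kap0 _ _] := bal.
elim: N st => [|N IH] st reg; first by rewrite big_geq// potential_ge0.
have [st0|st0] := boolP (stopped st).
  by rewrite big1 ?potential_ge0// => j _; rewrite total_survival_stopped.
rewrite big_nat_recl// total_survival0 st0 mulr1.
case: st st0 reg => A sw [] st0 reg.
  under eq_bigr do rewrite total_survival_padding.
  rewrite addrC; have := IH _ (reg : regular eps (State A sw false)).
  by rewrite /potential mulr1 mulr0 addr0 => H; rewrite lerD2r.
under eq_bigr do rewrite total_survivalS//.
rewrite big_split /= -!mulr_sumr big_split /=.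
have [uA _] := reg; apply: le_trans (potential_step eP bal reg st0).
rewrite -addrA lerD2l lerD//; last first.
  by rewrite ler_wpM2l ?lerD ?IH//; [lra|exact/regular_begin_round/refine_uniq..].
(* For [eps = 0] the state after an erasure may fail to be [regular], but it has weight zero. *)
have [->|en0] := eqVneq eps 0; first by rewrite !mul0r.
by rewrite ler_wpM2l ?IH//; [lra|exact: regular_erasure reg].
Qed.

(** By [xlnx_split_le] no split gains more than [kap] nats per use, so the potential without its
    correction terms falls on average by at most the elapsed time. Truncation at [N] forfeits at
    most [1 + ln k / kap] per surviving message. *)
Lemma total_sum_ge (R : realType) (eps p kap : R) K N (st : state K) :
  0 <= eps < 1 -> balanced eps p kap ->
  xlnx R (size (possible st)) / kap + (size (possible st))%:R * (padding st)%:R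
    - total_survival eps p N st * (1 + ln (size (possible st))%:R / kap)
  <= \sum_(0 <= j < N) total_survival eps p j st.
Proof.
move=> eP bal; have [pP kap0 E0 E1] := bal.
have eP' : 0 <= eps <= 1 by lra.
(* The coefficient is frozen at a bound [M] on the set sizes, so that it stays the same while the
   sets shrink. *)
suff H (M : nat) : (0 < M)%N -> (size (possible st) <= M)%N ->
    xlnx R (size (possible st)) / kap + (size (possible st))%:R * (padding st)%:R
    - total_survival eps p N st * (1 + ln M%:R / kap)
    <= \sum_(0 <= j < N) total_survival eps p j st.
  have [/size0nil k0|k0] := posnP (size (possible st)); last exact: H.
  rewrite k0 /xlnx !mul0r total_survival_empty// mul0r subr0 addr0.
  by apply: sumr_ge0 => j _; exact: total_survival_ge0.
move=> M0; have c0 : 0 <= ln M%:R / kap by rewrite divr_ge0 ?ln_ge0 ?ler1n// ltW.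
elim: N st => [|N IH] st stM.
  rewrite big_geq// total_survival0 subr_le0.
  set k := size (possible st) in stM *.
  have kM : xlnx R k / kap <= k%:R * (ln M%:R / kap).
    rewrite /xlnx; have [->|k0] := posnP k; first by rewrite !mul0r.
    rewrite -mulrA ler_wpM2l// ler_pM2r ?invr_gt0// ler_ln ?posrE ?ltr0n//.
    by rewrite ler_nat.
  have [st0|st0] := boolP (stopped st); last first.
    rewrite mulr1 mulrDr mulr1 addrC lerD//.
    by case: (padding st); rewrite ?mulr1 ?mulr0.
  rewrite mulr0 mul0r; have /andP[k1 /negbTE ->] := st0; rewrite mulr0 addr0.
  have : (k <= 1)%N by exact: k1.
  by rewrite /xlnx; case: k {kM stM k1} => [|[|]]// _; rewrite ?ln1 ?mulr0 ?mul0r ?mul0r.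
have [st0|st0] := boolP (stopped st).
  rewrite big1 => [|j _]; last by rewrite total_survival_stopped.
  rewrite total_survival_stopped// mul0r subr0.
  have /andP[k1 /negbTE ->] := st0; rewrite mulr0 addr0.
  have : (size (possible st) <= 1)%N by exact: k1.
  by rewrite /xlnx; case: size => [|[|]]// _; rewrite ?ln1 ?mulr0 ?mul0r ?mul0r.
rewrite big_nat_recl// total_survival0 st0 mulr1.
case: st st0 stM => A sw [] st0 /= AM.
  under eq_bigr do rewrite total_survival_padding.
  have := IH (State A sw false) AM; rewrite total_survival_padding /= mulr0 mulr1; lra.
under eq_bigr do rewrite total_survivalS//.
rewrite big_split /= -!mulr_sumr big_split /= total_survivalS//.
have k0M := leq_trans (leq_addr _ _) (eq_leq (size_refine p A sw)).
have k1M := leq_trans (leq_addl _ _) (eq_leq (size_refine p A sw)).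
have := IH (State A (~~ sw) false) AM.
have := IH (begin_round eps p (refine p A sw false) false) (leq_trans k0M AM).
have := IH (begin_round eps p (refine p A sw true) true) (leq_trans k1M AM).
rewrite /= !mulr0 !mulr1 !addr0.
have p01 : 0 < p < 1 by lra.
have := xlnx_split_le (size (refine p A sw false)) (size (refine p A sw true)) p01.
rewrite size_refine.
have -> : (size A)%:R = (size (refine p A sw false))%:R +
    (size (refine p A sw true))%:R :> R by rewrite -natrD size_refine.
set k0 := (size (refine p A sw false))%:R; set k1 := (size (refine p A sw true))%:R.
set x := xlnx R (size A); set x0 := xlnx _ _; set x1 := xlnx _ _ => split_le H1 H0 H2.
have e0 : 0 <= eps by lra.
have e1 : 0 <= 1 - eps by lra.
have {H2} := ler_wpM2l e0 H2; have := ler_wpM2l e1 (lerD H0 H1).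
have : (1 - eps) * (x / kap - (x0 / kap + x1 / kap)) <= k0 + k1 + (1 - eps) * k1.
  rewrite -mulrDl -mulrBl mulrA ler_pdivrMr//.
  apply: le_trans (ler_wpM2l e1 split_le) _.
  by rewrite mulrDr !(mulrCA (1 - eps)) E0 E1 le_eqVlt; apply/orP; left; apply/eqP; ring.
lra.
Qed.

(** * Exponential tails *)

(** Since [expR x <= (1 - x)^-1], it suffices that [(1 + x + 2 * x ^+ 2) * (1 - x) = 1 + x ^+ 2 * (1
    - 2 * x)] is at least 1. *)
Lemma expR_le_quadratic (R : realType) (x : R) : x <= 1 / 2 ->
  expR x <= 1 + x + 2 * x ^+ 2.
Proof.
move=> x2; have y0 : 0 < 1 - x by lra.
rewrite -[x in expR x]opprK expRN; have := expR_ge1Dx (- x) => H.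
apply: le_trans (_ : (1 - x)^-1 <= _); first by rewrite lef_pV2 ?posrE ?expR_gt0//; lra.
rewrite -[_^-1]mul1r ler_pdivrMr//.
have : 0 <= x ^+ 2 * (1 - 2 * x) by rewrite mulr_ge0 ?sqr_ge0//; lra.
rewrite expr2; lra.
Qed.

(** Per message the potential is [ln k / kap] up to a constant independent of [k]. This yields the
    bounded increments and the additive constant in the time bounds. *)
Lemma potential_ratio (R : realType) (eps kap : R) K (st : state K) :
  0 <= eps < 1 -> 0 < kap -> (0 < size (possible st))%N ->
  let k : R := (size (possible st))%:R in
  0 <= potential eps kap st / k - ln k / kap <= offset eps kap + 2 / eps + 1.
Proof.
move=> eP kap0; case: st => A sw pad /= k_gt0; rewrite natr_pred//.
have D0 := offset_ge0 eP kap0.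
have E0 : 0 <= 2 / eps by rewrite divr_ge0//; lra.
have : 1 <= (size A)%:R :> R by rewrite (ler_nat R 1).
rewrite /xlnx; set k : R := (size A)%:R => k1; have k0 : 0 < k by lra.
have -> : (k * ln k / kap + offset eps kap * (k - 1) + 2 / eps * ((size A == 2) && ~~ sw)%:R
   + k * pad%:R) / k - ln k / kap = offset eps kap * (1 - k^-1)
   + 2 / eps * (((size A == 2) && ~~ sw)%:R * k^-1) + pad%:R.
  by move: (2 / eps) => E; field; rewrite !lt0r_neq0.
have i0 : 0 <= k^-1 by rewrite invr_ge0 ltW.
have i1 : k^-1 <= 1 by rewrite invf_le1.
have b01 (b : bool) : 0 <= (b%:R : R) <= 1 by case: b; rewrite lexx ler01.
have /andP[p0 p1] := b01 pad; have /andP[b0 b1] := b01 ((size A == 2) && ~~ sw).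
have j0 : 0 <= 1 - k^-1 by rewrite subr_ge0.
have bi0 := mulr_ge0 b0 i0.
have bi1 : ((size A == 2) && ~~ sw)%:R * k^-1 <= 1 by rewrite mulr_ile1.
apply/andP; split; first exact: addr_ge0 (addr_ge0 (mulr_ge0 D0 j0) (mulr_ge0 E0 bi0)) p0.
apply: lerD => //; apply: lerD.
  by rewrite -[leRHS]mulr1 ler_wpM2l// lerBlDr lerDl.
by rewrite -[leRHS]mulr1 ler_wpM2l.
Qed.

(** A nonempty part of size [k'] satisfies [k' > k / 3 - 1] and [k' >= 1], hence
    [k < 3 * k' + 3 <= 6 * k']. *)
Lemma size_refine_large (R : realType) (p : R) K (A : seq 'I_K) sw b :
  1 / 3 < p < 1 / 2 -> uniq A -> (1 < size A)%N -> (0 < size (refine p A sw b))%N ->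
  (size A)%:R <= 6 * (size (refine p A sw b))%:R :> R.
Proof.
move=> pP uA k2; have [+ _] := size_refine_true sw pP uA k2; rewrite ltr_norml.
rewrite -(ler_nat R 1) -(ler_nat R 2) in k2 *.
case: b; first by move: (size _)%:R k2 => k k2 /=; nra.
have : (size A)%:R = (size (refine p A sw false))%:R
  + (size (refine p A sw true))%:R :> R by rewrite -natrD size_refine.
by move: (size A)%:R k2 => k k2 /=; nra.
Qed.

(** The 5 comes from [ln (k / k') <= k / k' - 1] with [k <= 6 * k']; the rest is the range in
    [potential_ratio]. *)
Definition increment (R : realType) (eps kap : R) : R :=
  5 / kap + (offset eps kap + 2 / eps + 1).

Lemma potential_increment (R : realType) (eps kap : R) K (st st' : state K) :
  0 <= eps < 1 -> 0 < kap -> (0 < size (possible st'))%N ->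
  (size (possible st') <= size (possible st))%N ->
  (size (possible st))%:R <= 6 * (size (possible st'))%:R :> R ->
  `|potential eps kap st' / (size (possible st'))%:R
     - potential eps kap st / (size (possible st))%:R| <= increment eps kap.
Proof.
move=> eP kap0 k'0 k'k k6.
have := potential_ratio eP kap0 k'0; have := potential_ratio eP kap0 (leq_trans k'0 k'k).
have k0 : 0 < (size (possible st))%:R :> R by rewrite ltr0n (leq_trans k'0).
have k'R : 0 < (size (possible st'))%:R :> R by rewrite ltr0n.
move: k'k; rewrite -(ler_nat R); move: k6 k0 k'R.
set k := (size _)%:R; set k' := (size _)%:R => k6 k0 k'R k'k /=.
have l0 : ln k' / kap <= ln k / kap by rewrite ler_pM2r ?invr_gt0// ler_ln ?posrE.
have l5 : ln k / kap - ln k' / kap <= 5 / kap.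
  rewrite -mulrBl ler_pM2r ?invr_gt0// -ln_div ?posrE//.
  have kk : k / k' <= 6 by rewrite ler_pdivrMr.
  have := @le_ln1Dx R (k / k' - 1); rewrite addrCA subrr addr0 => H.
  by apply: le_trans (H _) _; [rewrite ltrBDr addrC subrr divr_gt0|lra].
rewrite ler_norml /increment => H1 H2; lra.
Qed.

(** The exponential of an increment is replaced by a quadratic bound whose linear part will sum to
    the drift. The factor [k] keeps the bound true for an empty part, where both sides vanish. *)
Lemma tilt_le (R : realType) (lam L psi phi : R) (k : nat) :
  0 <= lam -> lam * L <= 1 / 2 -> (k = 0 -> phi = 0) ->
  ((0 < k)%N -> `|phi / k%:R - psi| <= L) ->
  k%:R * expR (lam * (phi / k%:R)) <=
  expR (lam * psi) * (k%:R + lam * (phi - k%:R * psi) + 2 * (lam * L) ^+ 2 * k%:R).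
Proof.
move=> lam0 lamL phi0 dL; have [k0|k_gt0] := posnP k.
  by rewrite phi0 ?k0// !mul0r subr0 !mulr0 !addr0 mulr0.
have kR : 0 < k%:R :> R by rewrite ltr0n.
have {dL} := dL k_gt0; set d := _ - psi => dL.
have -> : lam * (phi / k%:R) = lam * psi + lam * d by rewrite /d; ring.
have -> : phi - k%:R * psi = k%:R * d by rewrite /d; field; rewrite lt0r_neq0.
rewrite expRD mulrCA ler_pM2l ?expR_gt0//.
have -> : k%:R + lam * (k%:R * d) + 2 * (lam * L) ^+ 2 * k%:R =
  k%:R * (1 + lam * d + 2 * (lam * L) ^+ 2) by ring.
rewrite ler_pM2l//; have ld : `|lam * d| <= lam * L by rewrite normrM ger0_norm// ler_wpM2l.
apply: le_trans (expR_le_quadratic _) _.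
  by apply: le_trans (ler_norm _) _; exact: le_trans lamL.
rewrite lerD2l ler_pM2l// -(real_normK (num_real (lam * d))).
by rewrite lerXn2r// ?nnegrE// (le_trans _ ld).
Qed.

(** A Chernoff bound: the drift of -1 per use multiplies the exponential moment by [1 - lam], up to
    a second-order term controlled by the bounded increments. *)
Lemma total_survival_exp_le (R : realType) (eps p kap lam : R) K n (st : state K) :
  0 <= eps < 1 -> balanced eps p kap -> 0 <= lam -> lam * increment eps kap <= 1 / 2 ->
  regular eps st ->
  total_survival eps p n st <= (size (possible st))%:R
    * (1 - lam + 2 * (lam * increment eps kap) ^+ 2) ^+ n
    * expR (lam * (potential eps kap st / (size (possible st))%:R)).
Proof.
move=> eP bal lam0 lamL; have [pP kap0 _ _] := bal.
set L := increment eps kap in lamL *; set rho := 1 - lam + _.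
have D0 := offset_ge0 eP kap0.
have E0 : 0 <= 2 / eps by rewrite divr_ge0//; lra.
have i0 : 0 <= 5 / kap by rewrite divr_ge0// ltW.
have L1 : 1 <= L by rewrite /L /increment; lra.
have lam2 : lam <= 1 / 2 by apply: le_trans lamL; rewrite -[leLHS]mulr1 ler_wpM2l.
have rho0 : 0 <= rho by rewrite addr_ge0 ?mulr_ge0 ?sqr_ge0//; lra.
elim: n st => [|n IH] st reg.
  rewrite total_survival0 expr0 mulr1 ler_wpM2l// (@le_trans _ _ 1)//.
    by case: (~~ _).
  by rewrite -[leLHS]expR0 ler_expR mulr_ge0// divr_ge0// potential_ge0.
have [st0|st0] := boolP (stopped st).
  by rewrite total_survival_stopped// !mulr_ge0 ?exprn_ge0 ?expR_ge0.
case: st st0 reg => A sw pad st0 reg; set k := (size A)%:R : R.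
set psi := potential eps kap (State A sw pad) / k.
suff H : total_survival eps p n.+1 (State A sw pad) <=
    rho ^+ n * (expR (lam * psi) * (k * rho)).
  by apply: le_trans H _; rewrite le_eqVlt exprS /=; apply/orP; left; apply/eqP; ring.
have r0 : 0 <= rho ^+ n by rewrite exprn_ge0.
have step_le (st' : state K) : regular eps st' ->
    ((0 < size (possible st'))%N ->
      `|potential eps kap st' / (size (possible st'))%:R - psi| <= L) ->
    total_survival eps p n st' <= rho ^+ n * (expR (lam * psi) *
      ((size (possible st'))%:R
        + lam * (potential eps kap st' - (size (possible st'))%:R * psi)
        + 2 * (lam * L) ^+ 2 * (size (possible st'))%:R)).
  move=> reg' dL; apply: le_trans (IH _ reg') _.
  rewrite mulrAC [leLHS]mulrC ler_wpM2l//.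
  apply: tilt_le => //; case: st' {reg' dL} => A' sw' pad' /= ->.
  by rewrite /xlnx !mul0r !mulr0 !addr0.
have E_gt0 := expR_gt0 (lam * psi).
have [k0|k_gt0] := posnP (size A).
  have A0 : A = [::] by apply/eqP; rewrite -size_eq0 k0.
  by rewrite total_survival_empty// /k k0 !mul0r !mulr0.
have kR : 0 < k by rewrite ltr0n.
have kpsi : k * psi = potential eps kap (State A sw pad).
  by rewrite /psi mulrC divfK// lt0r_neq0.
case: pad st0 reg @psi step_le E_gt0 kpsi => st0 reg psi step_le E_gt0 kpsi.
  have pE : potential eps kap (State A sw false) = k * psi - k.
    by rewrite kpsi /= mulr0 mulr1 /k; ring.
  rewrite total_survival_padding; apply: le_trans (step_le (State A sw false) reg _) _.
    move=> _; rewrite pE /= -/k.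
    have -> : (k * psi - k) / k - psi = -1 by field; rewrite lt0r_neq0.
    by rewrite normrN1.
  rewrite pE /= -/k ler_wpM2l// ler_pM2l// le_eqVlt; apply/orP; left; apply/eqP.
  by rewrite /rho; ring.
have k2 := stopped_size st0; have [uA _] := reg.
rewrite total_survivalS//.
have refine_le b : total_survival eps p n (begin_round eps p (refine p A sw b) b) <=
   rho ^+ n * (expR (lam * psi) * ((size (refine p A sw b))%:R + lam * (
     potential eps kap (begin_round eps p (refine p A sw b) b) -
      (size (refine p A sw b))%:R * psi) + 2 * (lam * L) ^+ 2 * (size (refine p A sw b))%:R)).
  apply: (step_le (begin_round eps p (refine p A sw b) b)).
    exact/regular_begin_round/refine_uniq.
  move=> kb; apply: (potential_increment (st := State A sw false)) => //=.
    by rewrite size_filter count_size.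
  exact: size_refine_large.
have erasure_le : eps * total_survival eps p n (State A (~~ sw) false) <= eps *
   (rho ^+ n * (expR (lam * psi) * (k + lam * (
     potential eps kap (State A (~~ sw) false) - k * psi) + 2 * (lam * L) ^+ 2 * k))).
  have [->|en0] := eqVneq eps 0; first by rewrite !mul0r.
  rewrite ler_wpM2l//; first by lra.
  apply: (step_le (State A (~~ sw) false)); first exact: regular_erasure reg.
  move=> _; apply: (potential_increment (st := State A sw false)) => //=.
  by rewrite -/k; lra.
have e1 : 0 <= 1 - eps by lra.
apply: le_trans (lerD erasure_le (ler_wpM2l e1 (lerD (refine_le false) (refine_le true)))) _.
have := potential_step eP bal reg st0; rewrite -kpsi -/k.
have : (size (refine p A sw false))%:R + (size (refine p A sw true))%:R = k.
  by rewrite -natrD size_refine.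
move: (size _)%:R => k1; move: (size _)%:R => k0.
move: (potential _ _ _) => P0; move: (potential _ _ _) => P1; move: (potential _ _ _) => P2.
move=> kE pot_le.
(* All successors are compared with the same [psi], so their linear terms add up to the drift, which
   [potential_step] bounds by [- k]. *)
apply: (@le_trans _ _ (rho ^+ n * (expR (lam * psi) *
  (k + lam * (eps * P0 + (1 - eps) * (P1 + P2) - k * psi) + 2 * (lam * L) ^+ 2 * k)))).
  rewrite le_eqVlt; apply/orP; left; apply/eqP; rewrite -kE; ring.
rewrite ler_wpM2l// ler_pM2l// /rho.
have : lam * (eps * P0 + (1 - eps) * (P1 + P2) - k * psi) <= lam * - k.
  by rewrite ler_wpM2l//; lra.
lra.
Qed.

(** * Law and mean of the stopping time *)

Definition tail_prob (R : realType) (eps p : R) (K n : nat) : R :=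
  K%:R^-1 * total_survival eps p n (begin_round eps p (enum 'I_K) false).

Lemma tail_prob_ge0 (R : realType) (eps p : R) K n : 0 <= eps <= 1 -> 0 <= tail_prob eps p K n.
Proof. by move=> eP; rewrite mulr_ge0 ?invr_ge0// total_survival_ge0. Qed.

Lemma stop_time_probE (R : realType) (eps p : R) K n :
  stop_time_prob eps p K n =
  K%:R^-1 * \sum_(m < K) stopping eps p n (begin_round eps p (enum 'I_K) false) m.
Proof.
congr (_ * _); apply: eq_bigr => m _; rewrite big_mkcond; apply: eq_bigr => ys _ /=.
by rewrite /run first_stopE; case: first_stop; rewrite ?mulr1 ?mulr0.
Qed.

Lemma stop_time_prob0 (R : realType) (eps p : R) K : (0 < K)%N ->
  stop_time_prob eps p K 0 = 1 - tail_prob eps p K 0.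
Proof.
move=> K0; rewrite stop_time_probE /tail_prob total_survival0 /= size_enum_ord.
under eq_bigr do rewrite stopping0.
rewrite sumr_const card_ord -(mulr_natl (stopped _)%:R) !mulKf ?pnatr_eq0 ?gtn_eqF//.
by case: (stopped _) => /=; ring.
Qed.

Lemma stop_time_probS (R : realType) (eps p : R) K n :
  stop_time_prob eps p K n.+1 = tail_prob eps p K n - tail_prob eps p K n.+1.
Proof.
rewrite stop_time_probE -mulrBr /total_survival /= !big_enum -sumrB; congr (_ * _).
by apply: eq_bigr => m _; rewrite stopping_survival.
Qed.

Lemma sum_stop_time_prob (R : realType) (eps p : R) K n : (0 < K)%N ->
  \sum_(0 <= j < n.+1) stop_time_prob eps p K j = 1 - tail_prob eps p K n.
Proof.
move=> K0; elim: n => [|n IH]; first by rewrite big_nat1 stop_time_prob0.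
by rewrite big_nat_recr//= IH stop_time_probS; ring.
Qed.

(** Summation by parts; its boundary term is the reason for proving that
    [n%:R * tail_prob eps p K n] tends to 0. *)
Lemma sum_stop_time (R : realType) (eps p : R) K n :
  \sum_(0 <= j < n.+1) j%:R * stop_time_prob eps p K j =
  \sum_(0 <= j < n) tail_prob eps p K j - n%:R * tail_prob eps p K n.
Proof.
elim: n => [|n IH]; first by rewrite big_nat1 big_geq// !mul0r subr0.
rewrite big_nat_recr//= IH [in RHS]big_nat_recr//= stop_time_probS -natr1; ring.
Qed.

(* The constants are chosen so that the second order term
   [2 * (lam * increment) ^ 2] of [total_survival_exp_le] is [lam * eta / 2]. *)
Lemma tail_prob_exp_le (R : realType) (eps p kap eta : R) :
  0 <= eps < 1 -> balanced eps p kap -> 0 < eta <= 1 ->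
  exists lam : R, 0 < lam /\ forall K n, (0 < K)%N ->
    tail_prob eps p K n <= expR (lam * (ln K%:R / kap + (offset eps kap + 2 / eps + 1)
      - n%:R * (1 - eta / 2))).
Proof.
move=> eP bal etaP; have [pP kap0 _ _] := bal; set L := increment eps kap.
have D0 := offset_ge0 eP kap0.
have E0 : 0 <= 2 / eps by rewrite divr_ge0//; lra.
have i0 : 0 <= 5 / kap by rewrite divr_ge0// ltW.
have L1 : 1 <= L by rewrite /L /increment; lra.
have L0 : 0 < L by lra.
pose lam := eta / (4 * L ^+ 2).
have lam0 : 0 < lam by rewrite divr_gt0// ?mulr_gt0 ?exprn_gt0//; lra.
have lamL : lam * L <= 1 / 2.
  have -> : lam * L = eta / 4 * L^-1 by rewrite /lam; field; rewrite lt0r_neq0.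
  have : L^-1 <= 1 by rewrite invf_le1.
  have : 0 <= L^-1 by rewrite invr_ge0 ltW.
  move: L^-1 => x x0 x1; have : eta / 4 * x <= 1 * 1 by rewrite ler_pM//; lra.
  have : eta / 4 * x <= 1 / 4 * 1 by rewrite ler_pM//; lra.
  lra.
exists lam; split=> // K n K0; have KR : 0 < K%:R :> R by rewrite ltr0n.
have reg : regular eps (begin_round eps p (enum 'I_K) false).
  by apply: regular_begin_round => //; exact: enum_uniq.
have := total_survival_exp_le n eP bal (ltW lam0) lamL reg.
rewrite /= size_enum_ord => H.
rewrite /tail_prob ler_pdivrMl//; apply: le_trans H _.
rewrite -/L -mulrA ler_pM2l//.
have -> : 1 - lam + 2 * (lam * L) ^+ 2 = 1 + - (lam * (1 - eta / 2)).
  by rewrite /lam; field; rewrite lt0r_neq0.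
have r0 : 0 <= 1 + - (lam * (1 - eta / 2)).
  have : lam * (1 - eta / 2) <= 1 / 2 * 1.
    rewrite ler_pM//; [lra..|apply: le_trans lamL|lra].
    by rewrite -[leLHS]mulr1 ler_pM2l.
  lra.
have -> : lam * (ln K%:R / kap + (offset eps kap + 2 / eps + 1) - n%:R * (1 - eta / 2))
  = n%:R * - (lam * (1 - eta / 2)) +
    lam * (ln K%:R / kap + (offset eps kap + 2 / eps + 1)) by ring.
rewrite expRD ler_pM ?exprn_ge0 ?expR_ge0//.
  by rewrite expRM_natl lerXn2r ?nnegrE ?expR_ge0// expR_ge1Dx.
rewrite ler_expR ler_pM2l//.
have := @potential_ratio R eps kap K (begin_round eps p (enum 'I_K) false) eP kap0.
by rewrite /= size_enum_ord => /(_ K0); lra.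
Qed.

Lemma cvg_expR_linear (R : realType) (c a : R) : 0 < a ->
  (fun n => expR (c - n%:R * a)) @ \oo --> (0 : R).
Proof.
move=> a0; rewrite (_ : (fun n => _) = (fun n => expR c * expR (- a) ^+ n)); last first.
  by apply/funext => n; rewrite expRD -expRM_natl mulrN.
rewrite -[X in _ --> X](mulr0 (expR c)); apply: cvgM; first exact: cvg_cst.
by apply: cvg_expr; rewrite ger0_norm ?expR_ge0// expR_lt1 oppr_lt0.
Qed.

Lemma nneseries_EFin (R : realType) (f : nat -> R) (x : R) :
  (fun n => \sum_(0 <= j < n) f j) @ \oo --> x ->
  (\sum_(0 <= n <oo) (f n)%:E)%E = x%:E.
Proof.
move=> fx; apply: cvg_lim => //.
rewrite (_ : (fun n => _) = (fun n => (\sum_(0 <= j < n) f j)%:E)); last first.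
  by apply/funext => n; rewrite sumEFin.
by apply: cvg_EFin => //; apply: nearW.
Qed.

Lemma tail_prob_cvg0 (R : realType) (eps p kap : R) K :
  0 <= eps < 1 -> balanced eps p kap -> (0 < K)%N ->
  tail_prob eps p K @ \oo --> (0 : R) /\
  (fun n => n%:R * tail_prob eps p K n) @ \oo --> (0 : R).
Proof.
move=> eP bal K0; have eP' : 0 <= eps <= 1 by lra.
have [|lam [lam0 /(_ K _ K0)]] := tail_prob_exp_le eP bal (eta := 1); first by lra.
set B := _ + (_ + 1) => H.
have {}H n : tail_prob eps p K n <= expR (lam * B - n%:R * (lam / 2)).
  by apply: le_trans (H n) _; rewrite le_eqVlt; apply/orP; left; apply/eqP;
    congr expR; field.
split.
  apply: (@squeeze_cvgr _ _ _ _ (fun=> 0) (fun n => expR (lam * B - n%:R * (lam / 2)))).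
  - by apply: nearW => n; rewrite tail_prob_ge0// H.
  - exact: cvg_cst.
  - by apply: cvg_expR_linear; rewrite divr_gt0.
apply: (@squeeze_cvgr _ _ _ _ (fun=> 0)
  (fun n => 4 / lam * expR (lam * B - n%:R * (lam / 4)))).
- apply: nearW => n; rewrite mulr_ge0 ?tail_prob_ge0//=.
  (* Half of the decay rate [lam / 2] absorbs the factor [n]. *)
  have nE : n%:R <= 4 / lam * expR (n%:R * (lam / 4)).
    have := expR_ge1Dx (n%:R * (lam / 4)) => E1.
    rewrite [leLHS](_ : _ = 4 / lam * (n%:R * (lam / 4))); last first.
      by field; rewrite lt0r_neq0.
    by rewrite ler_pM2l ?divr_gt0//; apply: le_trans E1; rewrite lerDr.
  apply: le_trans (ler_pM _ _ nE (H n)) _ => //; first exact: tail_prob_ge0.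
  rewrite -[leLHS]mulrA -expRD le_eqVlt; apply/orP; left; apply/eqP.
  by congr (_ * expR _); field.
- exact: cvg_cst.
- rewrite -[X in _ --> X](mulr0 (4 / lam)).
  apply: cvgM; first exact: cvg_cst.
  by apply: cvg_expR_linear; rewrite divr_gt0.
Qed.

Lemma stop_time_prob_sum1 (R : realType) (eps p kap : R) K :
  0 <= eps < 1 -> balanced eps p kap -> (0 < K)%N ->
  (\sum_(0 <= n <oo) (stop_time_prob eps p K n)%:E)%E = 1%:E.
Proof.
move=> eP bal K0; apply: nneseries_EFin; rewrite -cvg_shiftS /=.
rewrite (_ : (fun n => _) = (fun n => 1 - tail_prob eps p K n)); last first.
  by apply/funext => n; rewrite sum_stop_time_prob.
have [S0 _] := tail_prob_cvg0 eP bal K0.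
by have := cvgB (cvg_cst (1 : R)) S0; rewrite subr0; exact.
Qed.

(** The mean is the limit of the tail sums [U], bounded by [total_sum_le] and [total_sum_ge]; the
    truncation term vanishes in the limit. The gap between the bounds does not depend on [K], which
    fixes the limiting rate. *)
Lemma expected_stop_time_bounds (R : realType) (eps p kap : R) K :
  0 <= eps < 1 -> balanced eps p kap -> (0 < K)%N ->
  exists2 x : R, expected_stop_time eps p K = x%:E
    & ln K%:R / kap <= x <= ln K%:R / kap + (offset eps kap + 2 / eps + 1).
Proof.
move=> eP bal K0; have eP' : 0 <= eps <= 1 by lra.
have [pP kap0 _ _] := bal; have KR : 0 < K%:R :> R by rewrite ltr0n.
have [S0 nS0] := tail_prob_cvg0 eP bal K0.
set st := begin_round eps p (enum 'I_K) false.
have reg : regular eps st by apply: regular_begin_round => //; exact: enum_uniq.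
pose U N : R := \sum_(0 <= j < N) tail_prob eps p K j.
have UE N : U N = K%:R^-1 * \sum_(0 <= j < N) total_survival eps p j st.
  by rewrite mulr_sumr.
have U_le N : U N <= ln K%:R / kap + (offset eps kap + 2 / eps + 1).
  rewrite UE ler_pdivrMl//; apply: le_trans (total_sum_le N eP bal reg) _.
  have := @potential_ratio R eps kap K st eP kap0.
  have -> : size (possible st) = K by rewrite /= size_enum_ord.
  move=> /(_ K0) /andP[_ ?].
  by rewrite [leRHS]mulrC -ler_pdivrMr// -lerBlDl.
have U_ge N : ln K%:R / kap - tail_prob eps p K N * (1 + ln K%:R / kap) <= U N.
  rewrite UE ler_pdivlMl//; apply: le_trans (total_sum_ge N st eP bal).
  rewrite /= size_enum_ord mulr0 addr0 /xlnx /tail_prob -/st.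
  rewrite le_eqVlt; apply/orP; left; apply/eqP; field.
  by rewrite !lt0r_neq0.
have U_homo : {homo U : n m / (n <= m)%N >-> n <= m}.
  move=> n m nm; rewrite /U (big_cat_nat _ nm)//= lerDl.
  by apply: sumr_ge0 => j _; exact: tail_prob_ge0.
have Ucvg : cvgn U.
  apply: nondecreasing_is_cvgn => //.
  by exists (ln K%:R / kap + (offset eps kap + 2 / eps + 1)) => _ [N _ <-]; exact: U_le.
exists (limn U).
  apply: nneseries_EFin; rewrite -cvg_shiftS /=.
  rewrite (_ : (fun n => _) = (fun n => U n - n%:R * tail_prob eps p K n)); last first.
    by apply/funext => n; rewrite sum_stop_time.
  by have := cvgB Ucvg nS0; rewrite subr0; exact.
apply/andP; split; last by apply: limr_le => //; exact: nearW.
apply: (@ler_cvg_to _ \oo _ _ (fun N => ln K%:R / kap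
    - tail_prob eps p K N * (1 + ln K%:R / kap)) U) => //; last exact: nearW.
have := cvgB (cvg_cst (ln K%:R / kap)) (cvgM S0 (cvg_cst (1 + ln K%:R / kap))).
by rewrite mul0r subr0; exact.
Qed.

Lemma ln_natr_cvgy (R : realType) : (fun n => ln n%:R : R) @ \oo --> +oo.
Proof.
have /cvgryPge idn_ge := @cvgr_idn R.
apply/cvgryPge => A; near=> n; have An : expR A <= n%:R by near: n; exact: idn_ge.
by rewrite -[A]expRK ler_ln ?posrE ?expR_gt0// (lt_le_trans (expR_gt0 A)).
Unshelve. all: by end_near. Qed.

Lemma scheme_rate_cvg (R : realType) (eps p kap : R) :
  0 <= eps < 1 -> balanced eps p kap ->
  (fun K => log2 K%:R / fine (expected_stop_time eps p K)) @ \oo --> kap / ln 2.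
Proof.
move=> eP bal; have [pP kap0 _ _] := bal; have l2 := ln2_gt0 R.
pose B := offset eps kap + 2 / eps + 1.
have B0 : 0 <= B.
  by rewrite /B !addr_ge0 ?offset_ge0// divr_ge0//; lra.
have C0 : 0 < kap / ln 2 by rewrite divr_gt0.
(* The lower function is [1 / (1 + t) >= 1 - t] at [t = kap * B / ln K], applied to
   [x * kap <= ln K + B * kap]. *)
apply: (@squeeze_cvgr _ _ _ _ (fun K => kap / ln 2 - kap / ln 2 * (kap * B) * (ln K%:R)^-1)
   (fun=> kap / ln 2)).
- near=> K; have K1 : (1 < K)%N by near: K; exact: nbhs_infty_gt.
  have lK : 0 < ln K%:R :> R by rewrite ln_gt0// ltr1n.
  have [x -> /= xP] := expected_stop_time_bounds eP bal (ltnW K1); rewrite -/B in xP.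
  have x0 : 0 < x by have := divr_gt0 lK kap0; lra.
  have k1 : ln K%:R <= x * kap by have /andP[+ _] := xP; rewrite ler_pdivrMr.
  have k2 : x * kap <= ln K%:R + B * kap.
    have /andP[_] := xP; rewrite -(ler_pM2r kap0) mulrDl divfK//; exact: lt0r_neq0.
  rewrite /log2 ler_pdivrMr// ler_pdivlMr//; apply/andP; split; last first.
    by rewrite mulrAC ler_pM2r ?invr_gt0// mulrC.
  have -> : (kap / ln 2 - kap / ln 2 * (kap * B) * (ln K%:R)^-1) * x =
    (x * kap - kap * B * (x * kap / ln K%:R)) / ln 2.
    by field; rewrite !lt0r_neq0.
  rewrite ler_pM2r ?invr_gt0//.
  have : 1 <= x * kap / ln K%:R by rewrite ler_pdivlMr// mul1r.
  have kB : 0 <= kap * B by rewrite mulr_ge0// ltW.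
  by move=> /(ler_wpM2l kB); lra.
- have lV : (fun K => (ln K%:R)^-1 : R) @ \oo --> (0 : R).
    apply/gtr0_cvgV0; last exact: ln_natr_cvgy.
    near=> K; have K1 : (1 < K)%N by near: K; exact: nbhs_infty_gt.
    by rewrite ln_gt0// ltr1n.
  have := cvgB (cvg_cst (kap / ln 2)) (cvgM (cvg_cst (kap / ln 2 * (kap * B))) lV).
  by rewrite mulr0 subr0; exact.
- exact: cvg_cst.
Unshelve. all: by end_near. Qed.

(** * Capacity *)

Lemma num_messages_ceil (R : realType) (r : R) n :
  (num_messages r n)%:R = (Num.ceil (2 `^ (n%:R * r)))%:~R :> R.
Proof.
rewrite /num_messages pmulrn gez0_abs// ceil_ge0.
by rewrite (lt_trans (ltrN10 R))// powR_gt0.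
Qed.

Lemma ln_num_messages_ge (R : realType) (r : R) n :
  n%:R * r * ln 2 <= ln (num_messages r n)%:R.
Proof.
rewrite -ln_powR ler_ln ?posrE ?powR_gt0//; last by rewrite ltr0n num_messages_gt0.
by rewrite num_messages_ceil ceil_ge.
Qed.

(** For [r >= 0] the power of 2 is at least 1, so rounding up at most doubles it. *)
Lemma ln_num_messages_le (R : realType) (r : R) n : 0 <= r ->
  ln (num_messages r n)%:R <= n%:R * r * ln 2 + ln 2.
Proof.
move=> r0; have x0 : 0 < 2 `^ (n%:R * r) :> R by rewrite powR_gt0.
rewrite -ln_powR -lnM ?posrE// ler_ln ?posrE ?mulr_gt0//; last first.
  by rewrite ltr0n num_messages_gt0.
rewrite num_messages_ceil; have /andP[+ _] := ceil_itv (2 `^ (n%:R * r) : R).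
rewrite intrB; have : 1 <= 2 `^ (n%:R * r) :> R.
  by rewrite -[leLHS](powRr0 2) ler_powR ?mulr_ge0// ler1n.
by lra.
Qed.

(** By [zero_error], the truncated scheme errs only if it has not stopped yet. *)
Lemma scheme_error_le (R : realType) (eps p : R) n K (K0 : (0 < K)%N) :
  0 <= eps <= 1 -> error_prob eps (scheme_code eps p n K0) <= tail_prob eps p K n.
Proof.
move=> eP; rewrite /error_prob /tail_prob ler_pM2l ?invr_gt0 ?ltr0n//.
rewrite /total_survival /= big_enum; apply: ler_sum => m _.
rewrite big_mkcond; apply: ler_sum => ys _ /=.
have P0 : 0 <= output_prob eps (scheme_enc eps p m) ys by exact: output_prob_ge0.
case: ifPn => [dec_neq|_]; last by rewrite mulr_ge0.
have [st|_] := boolP (stopped _); last by rewrite mulr1.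
rewrite mulr0; have [->//|Pn0] := eqVneq (output_prob eps (scheme_enc eps p m) ys) 0.
by move: dec_neq; rewrite (zero_error Pn0 st) eqxx.
Qed.

Lemma error_prob_ge0 (R : realType) (eps : R) n K (c : fb_code n K) :
  0 <= eps <= 1 -> 0 <= error_prob eps c.
Proof.
move=> eP; rewrite mulr_ge0 ?invr_ge0//; apply: sumr_ge0 => m _.
by apply: sumr_ge0 => ys _; exact: output_prob_ge0.
Qed.

Lemma scheme_error_cvg0 (R : realType) (eps p kap r : R) :
  0 <= eps < 1 -> balanced eps p kap -> 0 <= r -> r < kap / ln 2 ->
  (fun n => error_prob eps (scheme_code eps p n (num_messages_gt0 r n))) @ \oo
    --> (0 : R).
Proof.
move=> eP bal r0 rC; have [pP kap0 _ _] := bal; have l2 := ln2_gt0 R.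
have eP' : 0 <= eps <= 1 by lra.
(* The relative gap to the capacity: about [n * (1 - eta)] uses are needed on average, and the tail
   bound decays beyond [n * (1 - eta / 2)], which leaves a margin of [n * eta / 2]. *)
pose eta := 1 - r * ln 2 / kap.
have etaP : 0 < eta <= 1.
  rewrite /eta; have : 0 <= r * ln 2 / kap by rewrite !mulr_ge0// ?invr_ge0 ltW.
  have : r * ln 2 / kap < 1 by rewrite ltr_pdivrMr// mul1r -ltr_pdivlMr.
  lra.
have [lam [lam0 H]] := tail_prob_exp_le eP bal etaP.
set B := (offset _ _ + _ + _) in H.
apply: (@squeeze_cvgr _ _ _ _ (fun=> 0)
  (fun n => expR (lam * (ln 2 / kap + B) - n%:R * (lam * eta / 2)))).
- apply: nearW => n; rewrite error_prob_ge0//=.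
  apply: le_trans (scheme_error_le _ _ _ eP') _.
  apply: le_trans (H _ n (num_messages_gt0 r n)) _; rewrite ler_expR.
  have : ln (num_messages r n)%:R / kap <= n%:R * (1 - eta) + ln 2 / kap.
    have -> : n%:R * (1 - eta) + ln 2 / kap = (n%:R * r * ln 2 + ln 2) / kap.
      by rewrite /eta; field; rewrite lt0r_neq0.
    by rewrite ler_pM2r ?invr_gt0// ln_num_messages_le.
  move: (ln _ / kap) (ln 2 / kap) => x y xy.
  have -> : lam * (y + B) - n%:R * (lam * eta / 2) =
      lam * (n%:R * (1 - eta) + y + B - n%:R * (1 - eta / 2)) by field.
  by rewrite ler_pM2l//; lra.
- exact: cvg_cst.
- by apply: cvg_expR_linear; rewrite !mulr_gt0 ?invr_gt0//; lra.
Qed.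

Lemma achievable_le (R : realType) (eps p kap r : R) :
  0 <= eps <= 1 -> 0 < p < 1 -> (1 - eps) * - ln (1 - p) <= kap ->
  (1 - eps) * - ln p <= kap * (2 - eps) -> achievable eps r -> r * ln 2 <= kap.
Proof.
move=> eP pP k0 k1 [r0 [c c0]].
(* This is the bound of [converse] at length [n + 1], divided by [n + 1]. *)
have w : (fun n => kap + (kap + ln 2) * harmonic n) @ \oo --> (kap : R).
  have := cvgD (cvg_cst kap) (cvgM (cvg_cst (kap + ln 2)) (@cvg_harmonic R)).
  by rewrite mulr0 addr0; exact.
have c1 : (fun n => error_prob eps (c n.+1)) @ \oo --> (0 : R).
  by rewrite (cvg_shiftS (fun n => error_prob eps (c n) : R^o)).
have v : (fun n => (1 - error_prob eps (c n.+1)) * (r * ln 2)) @ \oo --> r * ln 2.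
  have := cvgM (cvgB (cvg_cst (1 : R)) c1) (cvg_cst (r * ln 2)).
  by rewrite subr0 mul1r; exact.
apply: ler_cvg_to v w _; near=> n.
have e1 : error_prob eps (c n.+1) < 1 by near: n; exact: cvgr_lt c1 _ ltr01.
have := converse (c n.+1) eP pP k0 k1 (num_messages_gt0 r n.+1).
have d0 : 0 <= 1 - error_prob eps (c n.+1) by rewrite subr_ge0 ltW.
have := ler_wpM2l d0 (ln_num_messages_ge r n.+1).
move: (1 - _) (ln (num_messages _ _)%:R) => d l H1 H2.
have n0 : 0 < n.+1%:R :> R by [].
rewrite -(ler_pM2l n0) mulrDr [in leRHS]mulrCA divff ?mulr1 ?lt0r_neq0//.
have -> : n.+1%:R * kap + (kap + ln 2) = kap * n.+2%:R + ln 2.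
  by rewrite -[n.+2%:R]natr1; ring.
by apply: le_trans H2; apply: le_trans H1; rewrite le_eqVlt; apply/orP; left; apply/eqP; ring.
Unshelve. all: by end_near. Qed.

(** Rate 0 means a single message. This bounds the supremum below by 0 when [eps = 1]. *)
Lemma achievable0 (R : realType) (eps : R) : achievable eps 0.
Proof.
split=> //; exists (fun n => scheme_code eps 0 n (num_messages_gt0 0 n)).
rewrite (_ : (fun n => _) = fun=> 0); first exact: cvg_cst.
apply/funext => n; rewrite /error_prob big1 ?mulr0// => m _; apply: big1 => ys.
have K1 (i j : 'I_(num_messages (0 : R) n)) : i = j.
  apply: ord_inj; move: (ltn_ord i) (ltn_ord j).
  rewrite {2 4}/num_messages mulr0 powRr0 ceil1.
  by rewrite !ltnS !leqn0 => /eqP -> /eqP ->.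
by rewrite (K1 (dec _ _) m) eqxx.
Qed.

Lemma fb_capacity_balanced (R : realType) (eps p kap : R) :
  0 <= eps < 1 -> balanced eps p kap -> fb_capacity eps = (kap / ln 2)%:E.
Proof.
move=> eP bal; have [pP kap0 E0 E1] := bal; have l2 := ln2_gt0 R.
apply/eqP; rewrite eq_le; apply/andP; split.
  apply: ge_ereal_sup => _ [r ach <-]; rewrite lee_fin ler_pdivlMr//.
  apply: (achievable_le (p := p)) ach; rewrite ?E0 ?E1//; lra.
have ach r : 0 <= r -> r < kap / ln 2 -> (r%:E <= fb_capacity eps)%E.
  move=> r0 rC; apply: ereal_sup_ubound; exists r => //; split => //.
  by exists (fun n => scheme_code eps p n (num_messages_gt0 r n));
    exact: scheme_error_cvg0 eP bal r0 rC.
have C0 : 0 < kap / ln 2 by rewrite divr_gt0.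
(* If the supremum [s] were below [kap / ln 2], their midpoint would be achievable; [sup0] excludes
   [-oo] and makes the midpoint nonnegative. *)
rewrite leNgt; apply/negP => supC.
have sup0 : (0%:E <= fb_capacity eps)%E by exact: ach.
move: supC sup0 ach; case: (fb_capacity eps) => // s; rewrite lte_fin lee_fin => sC s0.
move=> /(_ ((s + kap / ln 2) / 2)); rewrite lee_fin => H.
have : (s + kap / ln 2) / 2 <= s by apply: H; lra.
lra.
Qed.

Lemma fb_capacity1 (R : realType) : fb_capacity (1 : R) = 0%:E.
Proof.
have l2 := ln2_gt0 R.
apply/eqP; rewrite eq_le; apply/andP; split; last first.
  by apply: ereal_sup_ubound; exists 0 => //; exact: achievable0.
apply: ge_ereal_sup => _ [r ach <-]; rewrite lee_fin -(pmulr_lle0 _ l2).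
(* For [eps = 1] the factor [1 - eps] vanishes, so the converse applies with [kap = 0]. *)
by apply: (achievable_le (p := 1 / 2)) ach; rewrite ?subrr ?mul0r//; lra.
Qed.

Theorem theorem1 (R : realType) (eps : R) (heps : 0 <= eps <= 1) :
  (exists p : R, is_maximizer eps p /\ fb_capacity eps = (rate_fun eps p)%:E)
  /\
  (forall p : R, is_maximizer eps p ->
    [/\ (* zero error: upon stopping, the decoder announces the message sent *)
        forall (K : nat) (m : 'I_K) (ys : seq output),
          0 < output_prob eps (scheme_enc eps p m) ys ->
          stopped (run eps p K ys) ->
          scheme_dec eps p K ys = Some m,
        (* every rate below the capacity is achieved within n channel uses *)
        forall r : R, 0 <= r -> (r%:E < fb_capacity eps)%E ->
          (fun n => error_prob eps
             (scheme_code eps p n (num_messages_gt0 r n))) @ \oo --> (0 : R)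
      & (* the variable-length scheme stops almost surely, after a time of
           finite expectation, and its rate tends to the capacity *)
        eps < 1 ->
        (forall K : nat, (0 < K)%N ->
          (\sum_(0 <= n <oo) (stop_time_prob eps p K n)%:E)%E = 1%:E /\
          (expected_stop_time eps p K < +oo)%E) /\
        (fun K : nat => (log2 (K%:R : R) / fine (expected_stop_time eps p K))%:E)
          @ \oo --> fb_capacity eps]).
Proof.
have zero p K (m : 'I_K) ys : 0 < output_prob eps (scheme_enc eps p m) ys ->
    stopped (run eps p K ys) -> scheme_dec eps p K ys = Some m.
  by move=> P0; apply: (zero_error (eps := eps)); rewrite gt_eqF.
have /andP[e0] := heps; rewrite le_eqVlt => /predU1P[e1|e1].
  (* For [eps = 1] the rate function is constantly 0 and no nonnegative rate lies below the
     capacity. *)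
  rewrite e1 in zero *; have rate0 x : rate_fun (1 : R) x = 0 by rewrite /rate_fun eqxx.
  rewrite fb_capacity1; split.
    by exists 0; rewrite rate0; split=> //; split=> [|x _]; rewrite ?rate0//; lra.
  move=> p _; split=> [|r r0|]; first exact: zero.
    by rewrite lte_fin ltNge r0.
  by rewrite ltxx.
have eP : 0 <= eps < 1 by rewrite e0.
split.
  have [p [kap bal]] := balanced_exists eP; exists p; split.
    exact: balanced_maximizer bal.
  by rewrite (fb_capacity_balanced eP bal) (rate_fun_balanced eP bal).
move=> p /(maximizer_balanced eP)[kap bal]; rewrite (fb_capacity_balanced eP bal).
split=> [|r r0|_]; first exact: zero.
  by rewrite lte_fin => rC; exact: scheme_error_cvg0 bal r0 rC.
split=> [K K0|].
  split; first exact: stop_time_prob_sum1 bal K0.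
  by have [x -> _] := expected_stop_time_bounds eP bal K0; rewrite ltry.
by apply: cvg_EFin; [exact: nearW|exact: scheme_rate_cvg bal].
Qed.
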